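(* Let $T$ be a complete theory with monster model $\mathcal{U}$. (a) If $\mu\in\mathfrak{M}_x(\mathcal{U})$ is fim and $\nu\in\mathfrak{M}_y(\mathcal{U})$ is Borel definable, then $\mu\otimes\nu=\nu\otimes\mu$. (b) If $p\in S_x(\mathcal{U})$ is fim and $\nu\in\mathfrak{M}_y(\mathcal{U})$ is invariant, then $p\otimes\nu=\nu\otimes p$.
   Context: Global Keisler measures are identified with regular Borel probability measures on type spaces; types are $\{0,1\}$-valued measures. $\mu$ is invariant (over small $A$) if $\mu(\phi(x,b))=\mu(\phi(x,b'))$ whenever $b\equiv_A b'$; then $F^\phi_{\mu,A}(q)=\mu(\phi(x,b))$ for $b\models q\in S_y(A)$. $\mu$ is Borel definable (definable) if for some small $A$ it is $A$-invariant with every $F^\phi_{\mu,A}$ Borel (continuous). Morley product for $\mu$ Borel definable over $A$: $(\mu\otimes\nu)(\phi(x,y))=\int_{S_y(B)}F^\phi_{\mu,B}\,d(\nu|_B)$ for small $B\supseteq A$ with $\phi$ over $B$; for $\nu$ merely invariant over $A$ and $p$ a type, $(\nu\otimes p)(\phi(y,x))=\nu(\phi(y,a))$ for $a\models p|_A$. Powers: $\mu^{(1)}=\mu_{x_1}$, $\mu^{(n+1)}=\mu_{x_{n+1}}\otimes\mu^{(n)}$. $\mu$ is fim if for some small $M\prec\mathcal{U}$ and every $\mathcal{L}$-formula $\phi(x,y)$ there are consistent $\mathcal{L}_M$-formulas $\theta_n(x_1,\dots,x_n)$ with (i) for each $\epsilon>0$ some $n(\epsilon)$ such that $n\ge n(\epsilon)$,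 $\bar a\models\theta_n$ imply $|\mu(\phi(x,b))-\frac1n\sum_i\mathbf 1[\models\phi(a_i,b)]|<\epsilon$ for all $b$, and (ii) $\lim_n\mu^{(n)}(\theta_n)=1$. *)

(* Defs.v *)
From HB Require Import structures.
From mathcomp Require Import all_boot all_order all_algebra.
From mathcomp Require Import all_classical all_reals all_analysis.
Import Order.TTheory GRing.Theory Num.Theory.
Import numFieldNormedType.Exports.

Set Implicit Arguments.
Unset Strict Implicit.
Unset Printing Implicit Defensive.

Local Open Scope classical_set_scope.
Local Open Scope ring_scope.

(** * First-order logic *)

Record language := Language {
  fsym : Type;
  farity : fsym -> nat;
  rsym : Type;
  rarity : rsym -> nat }.

Section Syntax.
Variable L : language.

Inductive term (V : Type) : Type :=
| Var of V
| App (f : fsym L) of ('I_(farity f) -> term V).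

(* The free variables of a formula belong to V; a quantifier binds the new
   variable None of [option V]. *)
Inductive formula (V : Type) : Type :=
| Fls
| Eq of term V & term V
| Rel (r : rsym L) of ('I_(rarity r) -> term V)
| Imp of formula V & formula V
| All of formula (option V).

Arguments Fls {V}.

Fixpoint trename (V W : Type) (f : V -> W) (t : term V) : term W :=
  match t with
  | Var v => Var (f v)
  | App g args => App (fun i => trename f (args i))
  end.

Fixpoint rename (V W : Type) (f : V -> W) (phi : formula V) : formula W :=
  match phi with
  | Fls => Fls
  | Eq s t => Eq (trename f s) (trename f t)
  | Rel r args => Rel (fun i => trename f (args i))
  | Imp p q => Imp (rename f p) (rename f q)
  | All p => All (rename (omap f) p)
  end.

Record structure := Structure {
  carrier :> Type;
  carrier_inhabited : inhabited carrier;
  fint : forall f : fsym L, ('I_(farity f) -> carrier) -> carrier;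
  rint : forall r : rsym L, ('I_(rarity r) -> carrier) -> Prop }.

Fixpoint eval (M : structure) (V : Type) (v : V -> M) (t : term V) : M :=
  match t with
  | Var x => v x
  | App f args => fint (fun i => eval v (args i))
  end.

Fixpoint sat (M : structure) (V : Type) (phi : formula V) : (V -> M) -> Prop :=
  match phi with
  | Fls => fun=> False
  | Eq s t => fun v => eval v s = eval v t
  | Rel r args => fun v => rint (fun i => eval v (args i))
  | Imp p q => fun v => sat p v -> sat q v
  | All p => fun v => forall a, sat p (oapp v a)
  end.

Definition fnot (V : Type) (phi : formula V) : formula V := Imp phi Fls.
Definition fand (V : Type) (phi psi : formula V) : formula V :=
  fnot (Imp phi (fnot psi)).

Definition sentence := formula void.

Definition models (M : structure) (T : set sentence) :=
  forall phi, T phi -> sat phi (of_void M).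

Definition entails (T : set sentence) (phi : sentence) :=
  forall M : structure, models M T -> sat phi (of_void M).

Definition complete_theory (T : set sentence) :=
  (exists M, models M T) /\
  forall phi, entails T phi \/ entails T (fnot phi).

Definition elementary (N M : structure) (j : N -> M) :=
  forall n (phi : formula 'I_n) (v : 'I_n -> N), sat phi v <-> sat phi (j \o v).

(* [A] is the universe of an elementary substructure of [M]. *)
Definition elementary_submodel (M : structure) (A : set M) :=
  exists (N : structure) (j : N -> M), elementary j /\ range j = A.

Definition automorphism (M : structure) (s : M -> M) :=
  [/\ bijective s,
      forall (f : fsym L) (a : 'I_(farity f) -> M),
        s (fint a) = fint (s \o a) &
      forall (r : rsym L) (a : 'I_(rarity r) -> M),
        rint a <-> rint (s \o a)].

End Syntax.

Arguments Fls {L V}.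

Section Renaming.
Variables (L : language) (M : structure L).

Lemma eval_rename V W (f : V -> W) (t : term L V) (v : W -> M) :
  eval v (trename f t) = eval (v \o f) t.
Proof.
by elim: t => //= g args IH; congr fint; apply/funext => i; exact: IH.
Qed.

Lemma sat_rename V W (f : V -> W) (phi : formula L V) (v : W -> M) :
  sat (rename f phi) v <-> sat phi (v \o f).
Proof.
elim: phi W f v => {V} [V|V s t|V r args|V p IHp q IHq|V p IHp] W f v //=.
- by rewrite !eval_rename.
- suff -> : (fun i => eval v (trename f (args i)))
    = (fun i => eval (v \o f) (args i)) by [].
  by apply/funext => i; rewrite eval_rename.
- by split=> pq /IHp /pq /IHq.
- have E a : oapp v a \o omap f = oapp (v \o f) a by apply/funext; case.
  by split=> H a; move: (H a); rewrite IHp E.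
Qed.

End Renaming.

(** * Formulas with parameters and type spaces *)

Section Types.
Variables (L : language) (U : structure L).

(* An L_A-formula in the tuple of variables X has its free variables in
   X + A, where the elements of A stand for the parameters; L_U-formulas are
   obtained for A = setT. *)
Definition pformula (A : set U) (X : Type) := formula L (X + A).

Definition passign (A : set U) X (v : X -> U) (z : X + A) : U :=
  match z with inl x => v x | inr a => val a end.

Definition psat (A : set U) X (phi : pformula A X) (v : X -> U) :=
  sat phi (passign v).

Definition pmap (A B : set U) V W (f : V -> W) (AB : A `<=` B) (z : V + A) :
    W + B :=
  match z with inl x => inl (f x) | inr a => inr (subfun AB a) end.

Definition prename (A B : set U) V W (f : V -> W) (AB : A `<=` B)
  (phi : pformula A V) : pformula B W := rename (pmap f AB) phi.

Definition globalize (A : set U) X (phi : pformula A X) : pformula setT X :=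
  prename id (@subsetT _ A) phi.

Definition pure (A : set U) X (phi : formula L X) : pformula A X :=
  rename inl phi.

(* phi(x, y) |-> phi(x, b) *)
Definition inst (A : set U) X Y (phi : pformula A (X + Y)) (b : Y -> U) :
    pformula setT X :=
  rename (fun z => match z with
    | inl (inl x) => inl x
    | inl (inr y) => inr (to_setT (b y))
    | inr a => inr (to_setT (val a))
    end) phi.

Lemma psat_prename (A B : set U) V W (f : V -> W) (AB : A `<=` B)
    (phi : pformula A V) (v : W -> U) :
  psat (prename f AB phi) v <-> psat phi (v \o f).
Proof.
rewrite /psat /prename sat_rename.
by suff -> : passign v \o pmap f AB = passign (v \o f) by []; apply/funext; case.
Qed.

Definition equiv_over (A : set U) X (b b' : X -> U) :=
  forall phi : pformula A X, psat phi b <-> psat phi b'.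

(* Complete types over A: finitely satisfiable in U, and maximal. *)
Record ctype (A : set U) (X : Type) := CType {
  tset :> pformula A X -> Prop;
  ctype_finsat : forall n (phi : 'I_n -> pformula A X),
    (forall i, tset (phi i)) -> exists v, forall i, psat (phi i) v;
  ctype_complete : forall phi, tset phi \/ tset (fnot phi) }.

Definition realizes (A : set U) X (b : X -> U) (q : ctype A X) :=
  forall phi, q phi -> psat phi b.

Lemma ctype_ext (A : set U) X (p q : ctype A X) :
  (forall phi, p phi -> q phi) -> p = q.
Proof.
move=> pq; have E : tset p = tset q.
  apply/seteqP; split=> [|phi qphi]; first exact: pq.
  have [//|/pq qn] := ctype_complete p phi.
  have [|v H] := @ctype_finsat _ _ q 2
    (fun i => if i == ord0 then phi else fnot phi).
    by move=> i; case: ifP.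
  by have := H ord_max (H ord0).
case: p q E {pq} => [p p1 p2] [q q1 q2] /= E; subst q.
by congr CType; exact: Prop_irrelevance.
Qed.

Section Tp.
Variables (A : set U) (X : Type) (b : X -> U).

Let tp_finsat n (phi : 'I_n -> pformula A X) :
  (forall i, psat (phi i) b) -> exists v, forall i, psat (phi i) v.
Proof. by exists b. Qed.

Let tp_complete (phi : pformula A X) : psat phi b \/ psat (fnot phi) b.
Proof. by have [|] := pselect (psat phi b); [left|right]. Qed.

Definition tp : ctype A X :=
  @CType A X [set phi | psat phi b] tp_finsat tp_complete.

End Tp.

Section Pull.
Variables (A B : set U) (V W : Type) (f : V -> W) (AB : A `<=` B).
Variable q : ctype B W.

Let tpull_finsat n (phi : 'I_n -> pformula A V) :
  (forall i, q (prename f AB (phi i))) -> exists v, forall i, psat (phi i) v.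
Proof.
move=> /(ctype_finsat (phi := fun i => prename f AB (phi i)))[v Hv].
by exists (v \o f) => i; exact/(psat_prename f AB)/Hv.
Qed.

Let tpull_complete (phi : pformula A V) :
  q (prename f AB phi) \/ q (prename f AB (fnot phi)).
Proof. exact: (ctype_complete q (prename f AB phi)). Qed.

(* The type over A of the tuple obtained from a realization of q by selecting
   the coordinates listed by f. *)
Definition tpull : ctype A V :=
  @CType A V [set phi | q (prename f AB phi)] tpull_finsat tpull_complete.

End Pull.

Lemma ctype_inhabited (A : set U) X : $|ctype A X|.
Proof. by have [u] := carrier_inhabited U; exact: squash (tp A (fun=> u)). Qed.

HB.instance Definition _ (A : set U) X := gen_eqMixin (ctype A X).
HB.instance Definition _ (A : set U) X := gen_choiceMixin (ctype A X).
HB.instance Definition _ (A : set U) X :=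
  isPointed.Build (ctype A X) (unsquash (ctype_inhabited A X)).

Definition clopen_of (A : set U) X (phi : pformula A X) : set (ctype A X) :=
  [set p | tset p phi].

Lemma clopen_ofC (A : set U) X (phi : pformula A X) :
  clopen_of (fnot phi) = ~` clopen_of phi.
Proof.
apply/seteqP; split=> p; last by have [] := ctype_complete p phi.
move=> pn pp; have [|v H] := @ctype_finsat _ _ p 2
  (fun i => if i == ord0 then phi else fnot phi); first by move=> i; case: ifP.
by have := H ord_max (H ord0).
Qed.

Lemma clopen_ofI (A : set U) X (phi psi : pformula A X) :
  clopen_of (fand phi psi) = clopen_of phi `&` clopen_of psi.
Proof.
rewrite clopen_ofC; apply/seteqP; split=> p.
- move=> np; split; apply: contrapT => h; apply: np.
  + have [//|pn] := ctype_complete p (Imp phi (fnot psi)).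
    have pnphi : p (fnot phi) by have [] := ctype_complete p phi.
    have [|v H] := @ctype_finsat _ _ p 2
      (fun i => if i == ord0 then fnot phi else fnot (Imp phi (fnot psi))).
      by move=> i; case: ifP.
    by case: (H ord_max) => /= /(H ord0).
  + have [//|pn] := ctype_complete p (Imp phi (fnot psi)).
    have pnpsi : p (fnot psi) by have [] := ctype_complete p psi.
    have [|v H] := @ctype_finsat _ _ p 2
      (fun i => if i == ord0 then fnot psi else fnot (Imp phi (fnot psi))).
      by move=> i; case: ifP.
    by case: (H ord_max) => /= _; exact: (H ord0).
- move=> [pphi ppsi] pimp.
  have [|v H] := @ctype_finsat _ _ p 3
    (fun i => if i == ord0 then phi else
              if i == ord_max then psi else Imp phi (fnot psi)).
    by move=> i; case: ifP => // _; case: ifP.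
  exact: (H (Ordinal (isT : (1 < 3)%N)) (H ord0) (H ord_max)).
Qed.

Definition type_open (A : set U) X : set_system (ctype A X) :=
  [set O | forall p : ctype A X, O p -> exists2 phi, p phi & clopen_of phi `<=` O].

Let type_openT A X : @type_open A X setT.
Proof.
move=> p _; have [pF|pT] := ctype_complete p Fls.
- by exists Fls.
- by exists (fnot Fls).
Qed.

Let type_openI A X : setI_closed (@type_open A X).
Proof.
move=> O1 O2 o1 o2 p [/o1[phi pphi sphi] /o2[psi ppsi spsi]].
exists (fand phi psi); first by rewrite -[_ _]/(clopen_of _ p) clopen_ofI.
by rewrite clopen_ofI; exact: setISS.
Qed.

Let type_open_bigU A X (I : Type) (O : I -> set (ctype A X)) :
  (forall i, type_open (O i)) -> type_open (\bigcup_i O i).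
Proof.
move=> oO p [i _ /oO[phi pphi sphi]]; exists phi => //.
by move=> q /sphi; exists i.
Qed.

(* The topology on S_X(A) with basis the sets of types containing a given
   L_A-formula. *)
HB.instance Definition _ (A : set U) X :=
  isOpenTopological.Build (ctype A X)
    (@type_openT A X) (@type_openI A X) (@type_open_bigU A X).

Lemma openE_ctype A X : @open (ctype A X) = @type_open A X.
Proof. by []. Qed.

Lemma open_clopen_of A X (phi : pformula A X) : open (clopen_of phi).
Proof. by rewrite openE_ctype => p pphi; exists phi. Qed.

Lemma hausdorff_ctype A X : hausdorff_space (ctype A X).
Proof.
rewrite open_hausdorff => p q /eqP pq.
have [phi pphi nqphi] : exists2 phi, p phi & ~ q phi.
  apply: contrapT => H; apply: pq; apply: ctype_ext => phi pphi.
  by apply: contrapT => nq; apply: H; exists phi.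
exists (clopen_of phi, clopen_of (fnot phi)) => /=.
  by rewrite !inE; split => //; rewrite clopen_ofC.
split; [exact: open_clopen_of | exact: open_clopen_of |].
by rewrite clopen_ofC setICr.
Qed.

Lemma compact_ctype A X : compact [set: ctype A X].
Proof.
rewrite compact_ultra => F UF _.
have fs n (phi : 'I_n -> pformula A X) :
    (forall i, F (clopen_of (phi i))) -> exists v, forall i, psat (phi i) v.
  move=> /filter_forall/filter_ex[p Hp].
  exact: ctype_finsat Hp.
have cp (phi : pformula A X) :
    F (clopen_of phi) \/ F (clopen_of (fnot phi)).
  by rewrite clopen_ofC; exact: in_ultra_setVsetC.
exists (CType (tset := [set phi | F (clopen_of phi)]) fs cp); split=> // O.
rewrite nbhsE => -[P [oP pP] sP].
have [phi pphi sphi] := oP _ pP.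
by apply: filterS pphi => q /sphi /sP.
Qed.

Lemma continuous_tpull A B V W (f : V -> W) (AB : A `<=` B) :
  continuous (tpull f AB).
Proof.
apply/continuousP => O; rewrite !openE_ctype => oO p /= Op.
have [phi pphi sphi] := oO _ Op.
by exists (prename f AB phi) => // q qphi; exact: sphi.
Qed.

Definition borel (A : set U) X := g_sigma_algebraType (@open (ctype A X)).

Lemma measurable_tpull A B V W (f : V -> W) (AB : A `<=` B) :
  measurable_fun setT (tpull f AB : borel B W -> borel A V).
Proof.
apply: (@measurability _ _ (borel B W) (borel A V) setT (tpull f AB)
  (@open (ctype A V))) => //.
move=> _ [P oP <-]; rewrite setTI; apply: sub_sigma_algebra.
by have /continuousP := @continuous_tpull A B V W f AB; exact.
Qed.

End Types.

(** * Keisler measures *)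

Section Keisler.
Variables (R : realType) (L : language) (U : structure L).

Definition regular (A : set U) X (m : set (borel A X) -> \bar R) :=
  forall E : set (borel A X), measurable E -> forall eps : R, 0 < eps ->
  exists C O : set (ctype A X),
    [/\ closed C, open O, C `<=` E, E `<=` O & (m (O `\` C) < eps%:E)%E].

(* M_X(A); global Keisler measures are those with A = setT. *)
Record keisler (A : set U) X := Keisler {
  kmeas :> probability (borel A X) R;
  kregular : regular kmeas }.

Definition gkeisler X := keisler setT X.

(* mu(phi) *)
Definition kval (A : set U) X (mu : keisler A X) (phi : pformula A X) : R :=
  fine (mu (clopen_of phi)).

Section Dirac.
Variables (A : set U) (X : Type) (p : ctype A X).

Let type_measure_regular : regular (dirac (p : borel A X) : probability _ R).
Proof.
move=> E mE eps e0; have cp : closed [set p].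
  exact/accessible_closed_set1/hausdorff_accessible/hausdorff_ctype.
have d0 (S : set (borel A X)) : ~ S p ->
    ((dirac (p : borel A X) : probability _ R) S < eps%:E)%E.
  by move=> nSp; rewrite [X in (X < _)%E]diracE memNset// lte_fin.
have [Ep|nEp] := pselect (E p).
- exists [set p], setT; split=> //; first exact: openT.
  + by move=> _ ->.
  + by apply: d0 => -[_]; exact.
- exists set0, (~` [set p]); split=> //; [exact: closed0|exact: closed_openC| |].
  + by move=> q Eq qp; apply: nEp; rewrite -qp.
  + by apply: d0 => -[npp _]; exact: (npp erefl).
Qed.

(* Types as {0,1}-valued measures. *)
Definition type_measure : keisler A X := Keisler type_measure_regular.

End Dirac.

HB.instance Definition _ (A : set U) X := gen_eqMixin (keisler A X).
HB.instance Definition _ (A : set U) X := gen_choiceMixin (keisler A X).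
HB.instance Definition _ (A : set U) X :=
  isPointed.Build (keisler A X) (type_measure point).

Section Push.
Variables (A B : set U) (V W : Type) (f : V -> W) (AB : A `<=` B).
Variable mu : keisler B W.

Definition kpush_fun : set (borel A V) -> \bar R :=
  pushforward mu (tpull f AB : borel B W -> borel A V).

Let kpush0 : kpush_fun set0 = 0%E.
Proof. by rewrite /kpush_fun /pushforward preimage_set0 measure0. Qed.

Let kpush_ge0 E : (0 <= kpush_fun E)%E.
Proof. by rewrite /kpush_fun /pushforward measure_ge0. Qed.

Let kpush_sigma_additive : semi_sigma_additive kpush_fun.
Proof.
have mt := @measurable_tpull L U A B V W f AB.
move=> F mF tF mUF; rewrite /kpush_fun /pushforward preimage_bigcup.
apply: measure_semi_sigma_additive.
- by move=> n; rewrite -[X in measurable X]setTI; exact: mt.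
- apply/trivIsetP => /= i j _ _ ij; rewrite -preimage_setI.
  by move/trivIsetP : tF => /(_ _ _ _ _ ij) ->//; rewrite preimage_set0.
- by rewrite -preimage_bigcup -[X in measurable X]setTI; exact: mt.
Qed.

HB.instance Definition _ := isMeasure.Build _ _ _ kpush_fun
  kpush0 kpush_ge0 kpush_sigma_additive.

Let kpushT : kpush_fun setT = 1%E.
Proof. by rewrite /kpush_fun /pushforward preimage_setT probability_setT. Qed.

HB.instance Definition _ := Measure_isProbability.Build _ _ _ kpush_fun kpushT.

Let closed_measurable (C : set (ctype B W)) :
  closed C -> measurable (C : set (borel B W)).
Proof.
move=> cC; rewrite -[C]setCK; apply: measurableC; apply: sub_sigma_algebra.
exact: closed_openC.
Qed.

(* The image of a closed set is closed, which gives inner regularity; apply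
   this to a set and to its complement. *)
Let kpush_inner (E : set (borel A V)) (eps : R) : measurable E -> 0 < eps ->
  exists C : set (ctype A V), [/\ closed C, C `<=` E &
    (kpush_fun (E `\` C) < eps%:E)%E].
Proof.
move=> mE e0; have mt := @measurable_tpull L U A B V W f AB.
have mE' : measurable (tpull f AB @^-1` E : set (borel B W)).
  by rewrite -[X in measurable X]setTI; exact: mt.
have [C [P [cC oP CE EP PC]]] := kregular mu mE' e0.
have cfC : closed (tpull f AB @` C).
  apply: compact_closed; first exact: hausdorff_ctype.
  apply: continuous_compact; last first.
    exact: (subclosed_compact cC (@compact_ctype L U B W)).
  exact/continuous_subspaceT/continuous_tpull.
exists (tpull f AB @` C); split => //.
  by move=> _ [c /CE ? <-].
have mfC : measurable (tpull f AB @` C : set (borel A V)).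
  rewrite -[X in measurable X]setCK; apply: measurableC.
  by apply: sub_sigma_algebra; exact: closed_openC.
apply: le_lt_trans PC; apply: (@le_measure _ _ _ mu); rewrite ?inE.
- rewrite -[X in measurable X]setTI; apply: mt => //; exact: measurableD.
- apply: measurableD; first exact: sub_sigma_algebra.
  exact: closed_measurable.
- move=> q [Eq nC]; split; first exact: EP.
  by move=> Cq; apply: nC; exists q.
Qed.

Let kpush_regular : regular kpush_fun.
Proof.
move=> E mE eps e0; have e20 : 0 < eps / 2 by rewrite divr_gt0.
have [C [cC CE hC]] := kpush_inner mE e20.
have [D [cD DE hD]] := kpush_inner (measurableC mE) e20.
have mcl (K : set (ctype A V)) : closed K -> measurable (K : set (borel A V)).
  move=> cK; rewrite -[K]setCK; apply: measurableC; apply: sub_sigma_algebra.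
  exact: closed_openC.
exists C, (~` D); split=> //; first exact: closed_openC.
  by move=> x Ex Dx; exact: (DE _ Dx).
have mCE : measurable (E `\` C) by apply: measurableD => //; exact: mcl.
have mDE : measurable (~` E `\` D).
  by apply: measurableD; [exact: measurableC|exact: mcl].
have -> : ~` D `\` C = (E `\` C) `|` (~` E `\` D).
  apply/seteqP; split=> x.
    by move=> [nD nC]; have [|] := pselect (E x); [left|right].
  by move=> [[Ex nC]|[nE nD]]; split => //; [move/DE|move/CE].
apply: (le_lt_trans (measureU2 _ mCE mDE)).
by rewrite [eps]splitr EFinD; exact: lteD.
Qed.

(* The image of mu under the map tpull of type spaces. *)
Definition kpush : keisler A V := @Keisler A V kpush_fun kpush_regular.

End Push.

Definition restrict (A : set U) X (mu : gkeisler X) : keisler A X :=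
  kpush id (@subsetT _ A) mu.

Definition sum_swap X Y (z : X + Y) : Y + X :=
  match z with inl x => inr x | inr y => inl y end.

(* Identifies M_YX(U) with M_XY(U). *)
Definition kswap X Y (mu : gkeisler (Y + X)) : gkeisler (X + Y) :=
  kpush (@sum_swap X Y) (@subset_refl _ setT) mu.

(* Equality of measures only concerns Borel sets: as functions on all sets,
   the values of library measures on nonmeasurable sets are arbitrary. *)
Definition keq (A : set U) X (mu nu : keisler A X) :=
  forall E : set (borel A X), measurable E -> mu E = nu E.

(** * Monster models *)

Definition card_lt T T' (A : set T) (B : set T') :=
  ((A #<= B) && ~~ (B #<= A))%card.

(* The cardinal kappa of a monster model is that of a type K. *)
Definition small (K : Type) (A : set U) := card_lt A [set: K].

Definition saturated (K : Type) :=
  forall A : set U, small K A ->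
  forall (X : finType) (q : ctype A X), exists b, realizes b q.

Definition strongly_homogeneous (K : Type) :=
  forall A : set U, small K A -> forall f : A -> U,
  (forall phi : formula L A, sat phi (val : A -> U) <-> sat phi f) ->
  exists2 s : U -> U, automorphism s & forall a : A, s (val a) = f a.

(* The first condition says that kappa is larger than |L| + aleph_0. *)
Definition monster (K : Type) (T : set (sentence L)) :=
  [/\ card_lt [set: formula L nat] [set: K], models U T, saturated K &
      strongly_homogeneous K].

(** * Invariant and Borel definable measures *)

Definition invariant_over (A : set U) X (mu : gkeisler X) :=
  forall (Y : finType) (phi : pformula A (X + Y)) (b b' : Y -> U),
    equiv_over A b b' -> kval mu (inst phi b) = kval mu (inst phi b').

Definition invariant_measure (K : Type) X (mu : gkeisler X) :=
  exists2 A : set U, small K A & invariant_over A mu.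

(* F^phi_{mu,A}: the value of mu(phi(x,b)) at any b realizing q. *)
Definition fiber (A : set U) X Y (mu : gkeisler X) (phi : pformula A (X + Y))
    (q : ctype A Y) : R :=
  xget 0 [set r | exists2 b, realizes b q & r = kval mu (inst phi b)].

Definition borel_definable_over (K : Type) (A : set U) X (mu : gkeisler X) :=
  [/\ small K A, invariant_over A mu &
      forall (Y : finType) (phi : pformula A (X + Y)),
        measurable_fun setT (fiber mu phi : borel A Y -> R)].

Definition borel_definable (K : Type) X (mu : gkeisler X) :=
  exists A : set U, borel_definable_over K A mu.

(** * Morley products *)

(* The defining equations of the Morley product of a Borel definable mu and nu,
   which determine omega on Borel sets. *)
Definition is_morley (K : Type) X Y (mu : gkeisler X) (nu : gkeisler Y)
    (omega : gkeisler (X + Y)) :=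
  forall A B : set U, borel_definable_over K A mu -> A `<=` B -> small K B ->
  forall phi : pformula B (X + Y),
    (kval omega (globalize phi))%:E =
    (\int[restrict B nu]_(q in setT) (fiber mu phi q)%:E)%E.

(* Unspecified unless mu is Borel definable. *)
Definition morley (K : Type) X Y (mu : gkeisler X) (nu : gkeisler Y) :
    gkeisler (X + Y) :=
  get [set omega | is_morley K mu nu omega].

(* The defining equations of the Morley product of an invariant nu and a type
   p. *)
Definition is_morley_type (K : Type) Y X (nu : gkeisler Y)
    (p : ctype [set: U] X) (omega : gkeisler (Y + X)) :=
  forall A B : set U, small K A -> invariant_over A nu ->
  A `<=` B -> small K B ->
  forall (phi : pformula B (Y + X)) (a : X -> U),
    realizes a (tpull id (@subsetT _ B) p) ->
    kval omega (globalize phi) = kval nu (inst phi a).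

(* Unspecified unless nu is invariant. *)
Definition morley_type (K : Type) Y X (nu : gkeisler Y)
    (p : ctype [set: U] X) : gkeisler (Y + X) :=
  get [set omega | is_morley_type K nu p omega].

(* A tuple of n blocks of variables x_1, ..., x_n is indexed by 'I_n * X; the
   last block is the left factor of mu (x) mu^(n). *)
Definition split_last n X (z : 'I_n.+1 * X) : X + 'I_n * X :=
  match unlift ord_max z.1 with
  | Some i => inr (i, z.2)
  | None => inl z.2
  end.

(* mu^(n+1) *)
Fixpoint power (K : Type) X (mu : gkeisler X) (n : nat) :
    gkeisler ('I_n.+1 * X) :=
  match n with
  | 0 => kpush snd (@subset_refl _ setT) mu
  | m.+1 => kpush (@split_last m.+1 X) (@subset_refl _ setT)
              (morley K mu (power K mu m))
  end.

(** * Frequency interpretation measures *)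

Definition pair_assign X Y (a : X -> U) (b : Y -> U) (z : X + Y) : U :=
  match z with inl x => a x | inr y => b y end.

(* 1/n times the number of i such that phi(a_i, b) holds *)
Definition average X Y (phi : formula L (X + Y)) n (a : 'I_n * X -> U)
    (b : Y -> U) : R :=
  n%:R^-1 * \sum_(i < n) `[< sat phi (pair_assign (fun x => a (i, x)) b) >]%:R.

(* The sequence theta is indexed so that theta n is a formula in the n + 1
   blocks x_1, ..., x_{n+1}. The first condition on theta, for all phi, makes
   mu definable, so the powers of mu are given by their defining equations. *)
Definition fim (K : Type) X (mu : gkeisler X) :=
  exists M : set U, [/\ small K M, elementary_submodel M &
    forall (Y : finType) (phi : formula L (X + Y)),
    exists theta : forall n, pformula M ('I_n.+1 * X),
    [/\ forall n, exists a, psat (theta n) a,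
        forall eps : R, 0 < eps -> exists N : nat, forall n, (N <= n)%N ->
          forall a, psat (theta n) a -> forall b : Y -> U,
          `| kval mu (inst (pure M phi) b) - average phi a b | < eps &
        (fun n => kval (power K mu n) (globalize (theta n))) @ \oo --> (1 : R)]].

End Keisler.

(* Main.v *)
(** Let a realize theta_n. Averaging the fim approximation of mu(phi(x,b)) over
   nu shows that (mu (x) nu)(phi) is within epsilon of the mean over i of
   nu(phi(a_i,y)). If nu is Borel definable, integrate this mean against
   mu^(n): all marginals of mu^(n) are mu, so the integral is
   (nu (x) mu)(phi), and mu^(n)(theta_n) tends to 1. If nu is only invariant
   and mu is a type p, then mu^(n)-almost every type restricts to p in each
   block of variables, so theta_n has a realization a all of whose blocks a_i
   realize p over a given small set, and the mean is (nu (x) p)(phi).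

   Both Morley products have to be shown to exist. Their values on formulas do
   not depend on the small set over which they are computed, because a union of
   two small sets is small; and a finitely additive function on formulas
   extends to a regular Borel measure on the type space. *)

Require Import Defs.
From HB Require Import structures.
From mathcomp Require Import all_boot all_order all_algebra.
From mathcomp Require Import all_classical all_reals all_analysis.
From mathcomp Require Import measurable_realfun.
From mathcomp Require Import lra.
Import Order.TTheory GRing.Theory Num.Theory.
Import numFieldNormedType.Exports.

Set Implicit Arguments.
Unset Strict Implicit.
Unset Printing Implicit Defensive.

Local Open Scope classical_set_scope.
Local Open Scope ring_scope.

(** * Unions of small sets *)

(** The defining equations of a product live on the spaces S(B) for many small B, while global
    measures live on S(U), whose types are in general not realized in U. The bridge is
    [generic_value]: a function of tuples that is invariant over some small set induces a function
    on S(U), whose value at q is read off at a realization of q over such a small set. Integrals can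
    then be compared on S(U), and an inequality between two integrands is proved at each q
    separately, by realizing q over a small set that decides the finitely many formulas involved.
    Before that, fim has to yield definability: up to epsilon, mu(phi(x,b)) is determined by which
    phi(a_i,b) hold for one realization a of theta_n, and by projection this becomes an open
    condition on the type of b over M. Definability supplies the measurability that averaging over
    nu and forming the powers of mu call for. Only values on formulas are ever computed; regularity
    together with compactness carries their equality over to all Borel sets. *)

Section Cardinals.

Lemma card_le_injP S T (A : set S) (B : set T) :
  (A #<= B)%card <-> exists f : A -> B, injective f.
Proof.
split=> [/card_leP[f]|[f fi]].
  by exists f => x y; apply: inj; rewrite inE.
by apply/card_leP/injfunPex; exists f => // x y _ _ /fi.
Qed.

Lemma card_leT_injP (S T : Type) :
  ([set: S] #<= [set: T])%card <-> exists f : S -> T, injective f.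
Proof.
rewrite card_le_injP; split=> -[f fi].
  by exists (fun x => val (f (to_setT x))) => x y /val_inj/fi/(congr1 val).
exists (fun x => to_setT (f (val x))) => x y /(congr1 val)/fi; exact: val_inj.
Qed.

(** Zorn's lemma on graphs of partial bijections: a maximal one is total or onto, since otherwise an
    unmatched pair could be added. *)
Lemma card_le_total S T (A : set S) (B : set T) : (A #<= B \/ B #<= A)%card.
Proof.
pose P (G : set (A * B)) :=
  forall u v, G u -> G v -> (u.1 = v.1 <-> u.2 = v.2).
have [F FP tF|G [GP Gmax]] := @Zorn_bigcup _ P.
  move=> u v [X FX Xu] [Y FY Yv].
  have [XY|YX] := tF _ _ FX FY.
    by apply: (FP _ FY) => //; exact: XY.
  by apply: (FP _ FX) => //; exact: YX.
have [aG|/existsNP[a aG]] := pselect (forall a, exists b, G (a, b)).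
  left; apply/card_le_injP; have [f fG] := choice aG.
  by exists f => x y fxy; have [_] := GP _ _ (fG x) (fG y); exact.
right; have [bG|/existsNP[b bG]] := pselect (forall b, exists a, G (a, b)).
  apply/card_le_injP; have [f fG] := choice bG.
  by exists f => x y fxy; have [+ _] := GP _ _ (fG x) (fG y); exact.
exfalso; apply: (Gmax ((a, b) |` G)).
  split; first by move=> x; right.
  by move=> /(_ (a, b)) H; apply: aG; exists b; apply: H; left.
have ab u : G u -> u.1 <> a /\ u.2 <> b.
  case: u => x y Gxy /=; split=> xy; first by apply: aG; exists y; rewrite -xy.
  by apply: bG; exists x; rewrite -xy.
move=> u v [->|Gu] [->|Gv] //=.
- by have [] := ab _ Gv; split=> /esym.
- by have [] := ab _ Gu.
- exact: GP.
Qed.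

(* A maximal family of injections nat -> T with pairwise disjoint images covers
   T up to a finite set, and each image splits into two copies of itself. *)
Lemma infinite_double T : infinite_set [set: T] ->
  exists j : T * bool -> T, injective j.
Proof.
move=> Tinf.
pose P (F : set (nat -> T)) :=
  forall f g, F f -> F g -> forall i k, f i = g k -> f = g /\ i = k.
have [C CP tC|F [FP Fmax]] := @Zorn_bigcup _ P.
  move=> f g [X CX Xf] [Y CY Yg].
  have [XY|YX] := tC _ _ CX CY => i k.
    by apply: (CP _ CY) => //; exact: XY.
  by apply: (CP _ CX) => //; exact: YX.
pose D := [set x | exists f i, F f /\ f i = x].
(* An infinite complement would contain the image of one more injection, against maximality. *)
have Dfin : finite_set (~` D).
  apply: contrapT => /infiniteP/card_le_injP[h hinj].
  pose h' i := val (h (to_setT i)).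
  have h'inj : injective h' by move=> x y /val_inj/hinj/(congr1 val).
  have h'D i : ~ D (h' i) by have := valP (h (to_setT i)); rewrite inE.
  have nF f i k : F f -> f k <> h' i.
    by move=> Ff e; apply: (h'D i); exists f, k.
  apply: (Fmax (h' |` F)).
    split; first by move=> x; right.
    by move=> /(_ h') H; apply: (h'D 0%N); exists h', 0%N; split=> //; apply: H; left.
  move=> f g [->|Ff] [->|Fg] i k; [by move/h'inj|by move/esym/nF=> []| |exact: FP].
  by move/nF => [].
have [d [dD dinj]] : exists d : T -> bool -> T, (forall x b, D x -> D (d x b)) /\
    forall x y b c, D x -> D y -> d x b = d y c -> x = y /\ b = c.
  have dP x : exists e : bool -> T, D x ->
      exists f i, [/\ F f, f i = x & e = fun b : bool => f (i.*2 + b)%N].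
    have [[f [i [Ff fi]]]|nDx] := pselect (D x); last by exists (fun=> x).
    by exists (fun b : bool => f (i.*2 + b)%N) => _; exists f, i.
  have [e eP] := choice dP; exists e; split.
    by move=> x b /eP[f [i [Ff _ ->]]]; exists f, (i.*2 + b)%N.
  move=> x y b c.
  move=> /eP[f [i [Ff <- ->]]] /eP[g [k [Fg <- ->]]] /(FP _ _ Ff Fg)[-> ik].
  have bc : b = c by move/(congr1 odd): ik; rewrite !oddD !odd_double !oddb.
  by split=> //; move: ik; rewrite bc => /addIn/double_inj ->.
have [f0 Ff0] : exists f, F f.
  apply: contrapT => nF; apply: Tinf; apply: sub_finite_set Dfin => x _.
  by move=> [f [i [Ff _]]]; apply: nF; exists f.
have [g ginj] : exists g : T -> nat, {in ~` D &, injective g}.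
  have : countable (~` D) by exact: finite_set_countable.
  by move/countable_injP=> -[g /= gi]; exists g => x y xD yD; exact: gi.
(* [s] squeezes all of T into [D]: points of [D] move into the even halves of their images, which
   leaves the odd half of the image of [f0] free for the finitely many remaining points. *)
pose s x : T := if x \in D then d x false else d (f0 (g x)) true.
have f0D n : D (f0 n) by exists f0, n.
have sD x : D (s x).
  by rewrite /s; case: ifPn => [/set_mem|_]; exact: dD.
have sinj : injective s.
  move=> x y; rewrite /s; case: ifPn => xD; case: ifPn => yD.
  - by move/dinj => [||-> //]; exact: set_mem.
  - by move/dinj => [||_ //]; [exact: set_mem|exact: f0D].
  - by move/dinj => [||_ //]; [exact: f0D|exact: set_mem].
  - move/dinj => [||/(FP _ _ Ff0 Ff0)[_ gxy] _]; try exact: f0D.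
    by apply: ginj => //; apply/mem_set; [move: xD|move: yD]; rewrite notin_setE.
exists (fun z => d (s z.1) z.2) => -[x b] [y c] /= /dinj[||/sinj -> -> //]; exact: sD.
Qed.

(** Tag each element with the set it is taken from; [infinite_double] absorbs the tag. *)
Lemma card_leU S T (A B : set S) (C : set T) : infinite_set C ->
  (A #<= C -> B #<= C -> A `|` B #<= C)%card.
Proof.
move=> Cinf /card_le_injP[f fi] /card_le_injP[g gi].
have [|j ji] := @infinite_double C; first by rewrite (eq_finite_set (card_setT C)).
have h (x : (A `|` B)) :
    {z : C * bool | (if z.2 then exists a : A, val a = val x /\ f a = z.1
                     else exists b : B, val b = val x /\ g b = z.1)}.
  apply: cid; have /set_mem[xA|xB] := valP x.
  - by exists (f (SigSub (mem_set xA)), true) => /=; exists (SigSub (mem_set xA)).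
  - by exists (g (SigSub (mem_set xB)), false) => /=; exists (SigSub (mem_set xB)).
apply/card_le_injP; exists (fun x => j (sval (h x))) => x y /ji.
case: (h x) => -[c b] /= hx; case: (h y) => -[c' b'] /= hy [? ?]; subst c' b'.
apply: val_inj; case: b hx hy => -[a [ax fa]] [a' [ay fa']].
- by rewrite -[LHS]ax -[RHS]ay (fi a a')// fa fa'.
- by rewrite -[LHS]ax -[RHS]ay (gi a a')// fa fa'.
Qed.

End Cardinals.

Section Small.
Variables (L : language) (U : structure L) (K : Type).
Hypothesis Kinf : infinite_set [set: K].

(** Let D be the larger of the two sets. If D is infinite, the union embeds in D and K does not; if
    D is finite, so is the union, whereas K is infinite. *)
Lemma smallU (A B : set U) : small K A -> small K B -> small K (A `|` B).
Proof.
have Kle (C D : set U) : small K C -> small K D -> (C #<= D)%card ->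
    small K (C `|` D).
  move=> /andP[CK _] /andP[DK KD] CD; rewrite /small /card_lt card_leU//=.
  apply/negP => KCD; have [Dfin|Dinf] := pselect (finite_set D).
    apply: Kinf; apply: card_le_finite KCD _; rewrite finite_setU; split=> //.
    exact: card_le_finite CD Dfin.
  by move/negP: KD; apply; apply: card_le_trans KCD _; exact: card_leU.
move=> sA sB; have [AB|BA] := card_le_total A B; first exact: Kle.
by rewrite setUC; exact: Kle.
Qed.

Lemma finite_small (A : set U) : finite_set A -> small K A.
Proof.
move=> Afin; apply/andP; split; last first.
  by apply/negP => /card_le_finite/(_ Afin)/Kinf.
apply: card_le_trans (finite_set_countable Afin) _; exact/infiniteP.
Qed.

End Small.

Lemma monster_infinite (L : language) (U : structure L) K T :
  monster U K T -> infinite_set [set: K].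
Proof.
move=> [/andP[/card_leT_injP[f fi] _] _ _ _]; apply/infiniteP/card_leT_injP.
by exists (fun n => f (Eq (Var L n) (Var L n))) => m n /fi[].
Qed.

(** * Formulas with finitely many parameters, definable sets *)

Section FiniteSupport.
Variable L : language.

Lemma trename_comp V W Z (f : V -> W) (g : W -> Z) (t : term L V) :
  trename g (trename f t) = trename (g \o f) t.
Proof. by elim: t => //= h args IH; congr App; apply/funext => i; exact: IH. Qed.

Lemma rename_comp V W Z (f : V -> W) (g : W -> Z) (phi : formula L V) :
  rename g (rename f phi) = rename (g \o f) phi.
Proof.
elim: phi W Z f g => {V} [V|V s t|V r args|V p IHp q IHq|V p IHp] W Z f g //=.
- by rewrite !trename_comp.
- by congr Rel; apply/funext => i; rewrite trename_comp.
- by rewrite IHp IHq.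
- by rewrite IHp; congr All; congr rename; apply/funext; case.
Qed.

Let bundle n V (args : 'I_n -> term L V) :
  (forall i, exists (W : finType) (f : W -> V) (t' : term L W),
    trename f t' = args i) ->
  exists (W : finType) (f : W -> V) (t' : 'I_n -> term L W),
    (fun i => trename f (t' i)) = args.
Proof.
move=> /choice[W /(_ _)/cid fP].
pose f i := sval (fP i); have tP i := cid (svalP (fP i)).
exists {i & W i}, (fun z => f _ (tagged z)),
  (fun i => trename (fun w => Tagged W w) (sval (tP i))).
by apply/funext => i; rewrite trename_comp (svalP (tP i)).
Qed.

Lemma term_finite_support V (t : term L V) :
  exists (W : finType) (f : W -> V) (t' : term L W), trename f t' = t.
Proof.
elim: t => [v|g args /bundle[W [f [t' <-]]]].
  by exists unit, (fun=> v), (Var L tt).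
by exists W, f, (App t').
Qed.

Lemma formula_finite_support V (phi : formula L V) :
  exists (W : finType) (f : W -> V) (psi : formula L W), rename f psi = phi.
Proof.
elim: phi => {V} [V|V s t|V r args|V p IHp q IHq|V p [W [f [psi <-]]]].
- by exists void, (of_void V), Fls.
- have [W [f [s' <-]]] := term_finite_support s.
  have [Z [g [t' <-]]] := term_finite_support t.
  exists (W + Z)%type, (fun z => match z with inl w => f w | inr z => g z end),
    (Eq (trename inl s') (trename inr t')) => /=.
  by rewrite !trename_comp.
- have /bundle[W [f [t' <-]]] := fun i => term_finite_support (args i).
  by exists W, f, (Rel t').
- move: IHp IHq => [W [f [p' <-]]] [Z [g [q' <-]]].
  exists (W + Z)%type, (fun z => match z with inl w => f w | inr z => g z end),
    (Imp (rename inl p') (rename inr q')) => /=.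
  by rewrite !rename_comp.
(* Several variables of [psi] may be sent to [None]. Those sent to [Some] form the new support, and
   [insub] collapses all others to the bound variable. *)
- have fP w : isSome (f w) -> {v | f w = Some v} by case: (f w) => // v; exists v.
  exists {w : W | isSome (f w)}, (fun w => sval (fP (val w) (valP w))),
    (All (rename (fun w => insub w) psi)) => /=.
  congr All; rewrite rename_comp; congr rename; apply/funext => w /=.
  case: insubP => [[w' w'P] _ /= <-|] /=; first by case: (fP _ _).
  by case: (f w).
Qed.

End FiniteSupport.

(** * Parameters exchanged for variables *)

Section FormulaParams.
Variables (L : language) (U : structure L).
Implicit Types A B : set U.

Lemma psat_inst A X Y (phi : pformula A (X + Y)) (b : Y -> U) (v : X -> U) :
  psat (inst phi b) v <-> psat phi (pair_assign v b).
Proof.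
rewrite /psat /inst sat_rename.
set f := (X in _ \o X); suff -> : passign v \o f = passign (pair_assign v b) by [].
by apply/funext; case=> [[]|].
Qed.

Lemma psat_pure A X (phi : formula L X) (v : X -> U) :
  psat (pure A phi) v <-> sat phi v.
Proof. by rewrite /psat /pure sat_rename. Qed.

Lemma psat_globalize A X (phi : pformula A X) (v : X -> U) :
  psat (globalize phi) v <-> psat phi v.
Proof. by rewrite psat_prename. Qed.

Lemma psat_fand A X (phi psi : pformula A X) (v : X -> U) :
  psat (fand phi psi) v <-> psat phi v /\ psat psi v.
Proof.
split=> [H|[p q] H]; last exact: H.
by split; apply: contrapT => n; apply: H => p q; exact: n.
Qed.

Definition formula_params A B Y (W : Type) (c : W -> B) (phi : pformula A (Y + W))
    (AB : A `<=` B) : pformula B Y :=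
  rename (fun z => match z with
    | inl (inl y) => inl y
    | inl (inr w) => inr (c w)
    | inr a => inr (subfun AB a)
    end) phi.

Lemma psat_formula_params A B Y W (c : W -> B) (phi : pformula A (Y + W))
    (AB : A `<=` B) (v : Y -> U) :
  psat (formula_params c phi AB) v <-> psat phi (pair_assign v (val \o c)).
Proof.
rewrite /psat /formula_params sat_rename.
set f := (X in _ \o X); suff -> : passign v \o f = passign (pair_assign v (val \o c)) by [].
by apply/funext; case=> [[]|].
Qed.

Lemma pformula_finite_params B Y (phi : pformula B Y) :
  exists (W : finType) (c : W -> B) (psi : formula L (Y + W)),
    forall v, psat phi v <-> sat psi (pair_assign v (val \o c)).
Proof.
have [W [f [psi psiE]]] := formula_finite_support phi.
pose isr (z : Y + B) : bool := if z is inr _ then true else false.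
have gP w : isr (f w) -> {b | f w = inr b} by case: (f w) => // b; exists b.
pose W' : finType := {w : W | isr (f w)}.
pose c (w : W') : B := sval (gP (val w) (valP w)).
have /choice[g gE] w : exists z : Y + W', match f w with
    | inl y => z = inl y
    | inr b => exists2 w', z = inr w' & c w' = b
    end.
  case E : (f w) => [y|b]; first by exists (inl y).
  have wP : isr (f w) by rewrite E.
  exists (inr (exist _ w wP)), (exist _ w wP) => //.
  rewrite /c /=; move: (gP _ _) => [b' /=]; rewrite E => -[//].
exists W', c, (rename g psi) => v.
rewrite /psat -psiE !sat_rename.
suff -> : passign v \o f = pair_assign v (val \o c) \o g by [].
apply/funext => w /=; have := gE w; case: (f w) => [y ->//|b [w' -> <-]//].
Qed.

(** Only finitely many parameters occur in a formula. This brings every global formula under the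
    defining equations of the products, which speak of small parameter sets only. *)
Lemma globalize_small K A Y (phi : pformula setT Y) :
  infinite_set [set: K] -> small K A ->
  exists (B : set U) (psi : pformula B Y),
    [/\ A `<=` B, small K B & forall v, psat (globalize psi) v <-> psat phi v].
Proof.
move=> Kinf sA; have [W [c [psi psiE]]] := pformula_finite_params phi.
pose B := A `|` range (val \o c).
have cB w : B (val (c w)) by right; exists w.
pose c' w : B := SigSub (mem_set (cB w)).
exists B, (formula_params c' (pure _ psi) (@subset_refl _ B)); split.
- by move=> x; left.
- apply: smallU => //; apply: finite_small => //.
  by apply: finite_image; exact: finite_finset.
- by move=> v; rewrite psat_globalize psat_formula_params psat_pure psiE.
Qed.

End FormulaParams.

(** * Definable sets and their projections *)

Section Definable.
Variables (L : language) (U : structure L) (A : set U).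

(** Stated for sets rather than formulas, so that the formula [chi] in the proof that fim measures
    are definable can be assembled from Boolean operations and projections. *)
Definition definable V (D : set (V -> U)) :=
  exists phi : pformula A V, forall v, psat phi v <-> D v.

Lemma definableC V (D : set (V -> U)) : definable D -> definable (~` D).
Proof. by move=> [phi phiE]; exists (fnot phi) => v; split=> H /phiE/H. Qed.

Lemma definableI V (D E : set (V -> U)) :
  definable D -> definable E -> definable (D `&` E).
Proof.
move=> [phi phiE] [psi psiE]; exists (fand phi psi) => v.
by rewrite psat_fand phiE psiE.
Qed.

Lemma definableT V : definable [set: V -> U].
Proof. by exists (fnot Fls) => v; split=> // _ []. Qed.

Lemma definable_forall_ord V n (D : 'I_n -> set (V -> U)) :
  (forall i, definable (D i)) -> definable [set v | forall i, D i v].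
Proof.
elim: n D => [|n IH] D defD.
  rewrite (_ : mkset _ = setT); first exact: definableT.
  by apply/seteqP; split=> // v _ [].
rewrite (_ : mkset _ = D ord0 `&` [set v | forall i, D (lift ord0 i) v]).
  by apply: definableI => //; exact: (IH (fun i => D (lift ord0 i))).
apply/seteqP; split=> [v H|v [H0 H] i]; first by split=> [|i]; exact: H.
by have [j ->|->] := unliftP ord0 i; [exact: H|exact: H0].
Qed.

Lemma definable_subst V W (f : V -> W) (D : set (V -> U)) :
  definable D -> definable [set v : W -> U | D (v \o f)].
Proof.
move=> [phi phiE]; exists (prename f (@subset_refl _ A) phi) => v.
by rewrite psat_prename phiE.
Qed.

Lemma definable_exists V (D : set (option V -> U)) :
  definable D -> definable [set v : V -> U | exists a : U, D (oapp v a)].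
Proof.
move=> /definableC[phi phiE].
pose f (z : option V + A) : option (V + A) :=
  match z with inl (Some v) => Some (inl v) | inl None => None
  | inr a => Some (inr a) end.
exists (fnot (All (rename f phi))) => v.
have E a : sat (rename f phi) (oapp (passign v) a) <-> ~ D (oapp v a).
  apply: iff_trans (phiE (oapp v a)); rewrite sat_rename /psat.
  suff -> : oapp (passign v) a \o f = passign (oapp v a) by [].
  by apply/funext => -[[]|].
split=> [nH|[a Da]]; last by move=> /(_ a)/E.
by apply: contrapT => H; apply: nH => a; apply/E => Da; apply: H; exists a.
Qed.

Lemma definable_exists_ord n Y (D : set ('I_n + Y -> U)) :
  definable D -> definable [set b : Y -> U | exists a, D (pair_assign a b)].
Proof.
elim: n D => [|n IH] D defD.
  have no Z : 'I_0 -> Z by case.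
  pose f (z : 'I_0 + Y) : Y := match z with inl i => no Y i | inr y => y end.
  have := definable_subst f defD.
  congr definable; apply/seteqP; split=> b /=.
  - move=> Db; exists (no U); move: Db; congr D.
    by apply/funext => -[[]|].
  - by move=> [a Da]; move: Da; congr D; apply/funext => -[[]|].
pose f (z : 'I_n.+1 + Y) : option ('I_n + Y) := match z with
  | inl i => if unlift ord0 i is Some j then Some (inl j) else None
  | inr y => Some (inr y) end.
have := IH _ (definable_exists (definable_subst f defD)).
congr definable; apply/seteqP; split=> b /=.
- move=> [a [a0 Da]].
  exists (fun i => if unlift ord0 i is Some j then a j else a0).
  move: Da; congr D; apply/funext => -[i|//] /=.
  by case: (unlift ord0 i).
- move=> [a Da]; exists (fun i => a (lift ord0 i)), (a ord0).
  move: Da; congr D; apply/funext => -[i|//] /=.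
  by case: unliftP => [j|] ->.
Qed.

Lemma definable_exists_fin (V : finType) Y (D : set (V + Y -> U)) :
  definable D -> definable [set b : Y -> U | exists a, D (pair_assign a b)].
Proof.
pose f (z : V + Y) : 'I_#|V| + Y :=
  match z with inl v => inl (enum_rank v) | inr y => inr y end.
move=> /(definable_subst f)/definable_exists_ord.
congr definable; apply/seteqP; split=> b /= -[a Da].
- by exists (a \o enum_rank); move: Da; congr D; apply/funext => -[].
- exists (a \o enum_val); move: Da; congr D.
  by apply/funext => -[v|//] /=; rewrite enum_rankK.
Qed.

End Definable.

(** * Complete types, realizations and added parameters *)

Section Types.
Variables (L : language) (U : structure L).
Implicit Types A B : set U.

Lemma ctype_fnot A X (q : ctype A X) phi : q (fnot phi) <-> ~ q phi.
Proof. by have /seteqP[H1 H2] := clopen_ofC phi; split=> [/H1|/H2]. Qed.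

Lemma ctype_imp A X (q : ctype A X) (phi psi : pformula A X) :
  (forall v, psat phi v -> psat psi v) -> q phi -> q psi.
Proof.
move=> imp qphi; apply: contrapT => /ctype_fnot qn.
have [|v H] := @ctype_finsat _ _ _ _ q 2
  (fun i => if i == ord0 then phi else fnot psi); first by move=> i; case: ifP.
exact: (H ord_max (imp _ (H ord0))).
Qed.

Lemma ctype_equiv A X (q : ctype A X) (phi psi : pformula A X) :
  (forall v, psat phi v <-> psat psi v) -> q phi <-> q psi.
Proof. by move=> E; split; apply: ctype_imp => v /E. Qed.

Lemma clopen_of_sub A X (phi psi : pformula A X) :
  clopen_of phi `<=` clopen_of psi <-> (forall v, psat phi v -> psat psi v).
Proof.
split=> [sub v phiv|imp q]; last exact: ctype_imp.
exact: (sub (tp A v)).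
Qed.

Lemma clopen_of_equiv A X (phi psi : pformula A X) :
  (forall v, psat phi v <-> psat psi v) -> clopen_of phi = clopen_of psi.
Proof. by move=> E; apply/seteqP; split; apply/clopen_of_sub => v /E. Qed.

Lemma realizesE A X (q : ctype A X) (b : X -> U) phi :
  realizes b q -> q phi <-> psat phi b.
Proof.
move=> bq; split=> [/bq//|phib]; 
  by apply: contrapT => /ctype_fnot/bq; exact.
Qed.

Lemma realizes_equiv A X (q : ctype A X) (b b' : X -> U) :
  realizes b q -> realizes b' q -> equiv_over A b b'.
Proof. by move=> bq b'q phi; rewrite -(realizesE _ bq) (realizesE _ b'q). Qed.

Lemma equiv_overS A B X (b b' : X -> U) :
  A `<=` B -> equiv_over B b b' -> equiv_over A b b'.
Proof. by move=> AB E phi; have := E (prename id AB phi); rewrite !psat_prename. Qed.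

Lemma equiv_over_params A B Y W (c : W -> B) (b b' : Y -> U) : A `<=` B ->
  equiv_over B b b' ->
  equiv_over A (pair_assign b (val \o c)) (pair_assign b' (val \o c)).
Proof. by move=> AB E phi; rewrite -!(psat_formula_params c phi AB). Qed.

Section AddParams.
Variables (A B : set U) (Y W : Type) (c : W -> B) (AB : A `<=` B) (q : ctype B Y).

Let finsat n (phi : 'I_n -> pformula A (Y + W)) :
  (forall i, q (formula_params c (phi i) AB)) -> exists v, forall i, psat (phi i) v.
Proof.
move=> /(ctype_finsat (phi := fun i => formula_params c (phi i) AB))[v Hv].
by exists (pair_assign v (val \o c)) => i; apply/(psat_formula_params c _ AB)/Hv.
Qed.

Let complete (phi : pformula A (Y + W)) :
  q (formula_params c phi AB) \/ q (formula_params c (fnot phi) AB).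
Proof. exact: (ctype_complete q (formula_params c phi AB)). Qed.

(* tp(b/B) |-> tp(b,c/A) *)
Definition add_params : ctype A (Y + W) :=
  @CType _ _ A (Y + W)%type
    [set phi | q (formula_params c phi AB)] finsat complete.

Lemma realizes_add_params b : realizes b q ->
  realizes (pair_assign b (val \o c)) add_params.
Proof. by move=> bq phi /bq/psat_formula_params. Qed.

End AddParams.

Lemma measurable_add_params A B Y W (c : W -> B) (AB : A `<=` B) :
  measurable_fun setT (@add_params A B Y W c AB : borel B Y -> borel A (Y + W)).
Proof.
apply: (@measurability _ _ (borel B Y) (borel A (Y + W)%type) setT _
  (@open (ctype A (Y + W)%type))) => //.
move=> _ [P oP <-]; rewrite setTI; apply: sub_sigma_algebra.
rewrite openE_ctype => q /= Pq; have [phi qphi sphi] := oP _ Pq.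
by exists (formula_params c phi AB) => // r rphi; exact: sphi.
Qed.

End Types.

(** * Regular Borel extension of a finitely additive function on formulas *)

Section Clopen.
Variables (L : language) (U : structure L) (A : set U) (X : Type).
Implicit Types phi psi chi : pformula A X.

(** Compactness: C is covered by finitely many basic clopen sets inside P, and their union is again
    given by a formula. *)
Lemma clopen_between (C P : set (ctype A X)) : closed C -> open P -> C `<=` P ->
  exists phi, C `<=` clopen_of phi /\ clopen_of phi `<=` P.
Proof.
move=> cC oP CP.
have cptC : compact C by exact: subclosed_compact cC (@compact_ctype L U A X) _.
pose D := [set phi : pformula A X | clopen_of phi `<=` P].
(* Formulas inside P, directed by inclusion. Each point of C lies in [phi] for all large [phi],
   locally uniformly, so by compactness one [phi] contains all of C. *)
pose F := filter_from D (fun psi => [set phi | D phi /\ clopen_of psi `<=` clopen_of phi]).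
have FF : Filter F.
  apply: filter_from_filter.
    exists Fls => q /= qF; have [v []] := @ctype_finsat _ _ _ _ q 1 (fun=> Fls) (fun=> qF).
    exact: ord0.
  move=> phi psi Dphi Dpsi; exists (fnot (fand (fnot phi) (fnot psi))).
    move=> q; rewrite /D clopen_ofC clopen_ofI !clopen_ofC -setCU setCK.
    by move=> -[]; [exact: Dphi|exact: Dpsi].
  move=> chi [Dchi]; rewrite clopen_ofC clopen_ofI !clopen_ofC -setCU setCK.
  by rewrite subUset => -[].
have /compact_near_coveringP := cptC.
move=> /(_ _ F (fun phi q => q phi) FF) [|psi Dpsi H].
  move=> q Cq; have [psi qpsi spsi] := oP _ (CP _ Cq).
  exists (clopen_of psi, [set phi | D phi /\ clopen_of psi `<=` clopen_of phi]) => /=.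
    split; last by exists psi.
    by apply: open_nbhs_nbhs; split => //; exact: open_clopen_of.
  by move=> [r phi] /= [rpsi [_]]; apply.
by exists psi; split=> //; apply: (H psi); split.
Qed.

Lemma clopen_closed phi : closed (clopen_of phi).
Proof.
rewrite -[clopen_of phi]setCK -clopen_ofC; apply: open_closedC.
exact: open_clopen_of.
Qed.

End Clopen.

(* Extending m as a premeasure on the clopen sets would only reach the
   sigma-algebra that they generate, which is smaller than the Borel one when
   the language is uncountable; hence the outer measure through open sets. *)
Section Extension.
Variables (R : realType) (L : language) (U : structure L) (A : set U) (X : Type).
Variable m : pformula A X -> R.
Implicit Types phi psi chi : pformula A X.
Hypothesis m_ge0 : forall phi, 0 <= m phi.
Hypothesis mT : m (fnot Fls) = 1.
Hypothesis m_add : forall phi psi chi,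
  (forall v, psat chi v <-> psat phi v \/ psat psi v) ->
  (forall v, psat phi v -> ~ psat psi v) -> m chi = m phi + m psi.

Let mF : m Fls = 0.
Proof.
have : m Fls = m Fls + m Fls by apply: m_add => v; [split=> [|[]]|].
by move/(congr1 (fun x => x - m Fls)); rewrite subrr addrK.
Qed.

Let m_le phi psi : clopen_of phi `<=` clopen_of psi -> m phi <= m psi.
Proof.
move=> /clopen_of_sub imp.
rewrite (@m_add phi (fand psi (fnot phi)) psi) ?lerDl// => v.
  rewrite psat_fand; split; last by move=> [/imp|[]].
  by have [|] := pselect (psat phi v); [left|right].
by rewrite psat_fand => phiv [_]; exact.
Qed.

Local Open Scope ereal_scope.

Let lam (P : set (ctype A X)) : \bar R :=
  ereal_sup [set (m phi)%:E | phi in [set phi | clopen_of phi `<=` P]].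

Let lam_ub P phi : clopen_of phi `<=` P -> (m phi)%:E <= lam P.
Proof. by move=> sub; apply: ereal_sup_ubound; exists phi. Qed.

Let lam_le P y : (forall phi, clopen_of phi `<=` P -> (m phi)%:E <= y) -> lam P <= y.
Proof. by move=> H; apply: ge_ereal_sup => _ [phi sub <-]; exact: H. Qed.

Let lam_mono P Q : P `<=` Q -> lam P <= lam Q.
Proof. by move=> PQ; apply: lam_le => phi sub; apply: lam_ub => q /sub/PQ. Qed.

Let clopen_of_Fls : clopen_of (Fls : pformula A X) = set0.
Proof.
apply/seteqP; split=> // q qF.
have [v []] := @ctype_finsat _ _ _ _ q 1 (fun=> Fls) (fun=> qF); exact: ord0.
Qed.

Let lam_ge0 P : 0 <= lam P.
Proof. by apply: (le_trans _ (@lam_ub _ Fls _)); rewrite ?mF// clopen_of_Fls. Qed.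

Let lam_clopen phi : lam (clopen_of phi) = (m phi)%:E.
Proof.
apply/eqP; rewrite eq_le lam_ub// andbT.
by apply: lam_le => psi /m_le; rewrite lee_fin.
Qed.

Let lamT : lam setT = 1.
Proof. by rewrite -mT -lam_clopen clopen_ofC clopen_of_Fls setC0. Qed.

Let lam_fin P : lam P \is a fin_num.
Proof.
rewrite fin_numElt (lt_le_trans _ (lam_ge0 P))//=.
by rewrite (le_lt_trans (lam_mono (@subsetT _ P)))// lamT ltry.
Qed.

(** For a clopen [phi] inside the union, [phi] minus Q is a closed subset of P. A clopen [psi]
    between the two cuts [phi] into a part inside P and a part inside Q, on which [m] is
    additive. *)
Let lam_setU P Q : open P -> open Q -> lam (P `|` Q) <= lam P + lam Q.
Proof.
move=> oP oQ; apply: lam_le => phi sub.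
have [||psi [psi1 psi2]] := @clopen_between L U A X (clopen_of phi `\` Q) P _ oP.
- by apply: closedI; [exact: clopen_closed|exact: open_closedC].
- by move=> q [/sub[]].
have phiE v : psat phi v <-> psat (fand phi psi) v \/ psat (fand phi (fnot psi)) v.
  rewrite !psat_fand; split; last by move=> [[]|[]].
  by have [|] := pselect (psat psi v); [left|right].
rewrite (m_add phiE); last by move=> v; rewrite !psat_fand => -[_ H] [_]; exact.
rewrite EFinD; apply: leeD; apply: lam_ub; rewrite clopen_ofI.
- by move=> q [_ /psi2].
- rewrite clopen_ofC => q [phiq npsi]; apply: contrapT => nQ.
  exact: (npsi (psi1 _ (conj phiq nQ))).
Qed.

(** A clopen subset of the union is compact, hence contained in a finite subunion, where [lam_setU]
    applies. *)
Let lam_bigcup (P : nat -> set (ctype A X)) : (forall i, open (P i)) ->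
  lam (\bigcup_i P i) <= \sum_(i <oo) lam (P i).
Proof.
move=> oP; apply: lam_le => phi sub.
pose Q n := \bigcup_(i < n) P i.
have oQ n : open (Q n) by apply: bigcup_open.
have [n phiQ] : exists n, clopen_of phi `<=` Q n.
  have : compact (clopen_of phi).
    exact: subclosed_compact (@clopen_closed _ _ _ _ phi) (@compact_ctype L U A X) _.
  move/compact_near_coveringP/(_ nat \oo (fun n q => Q n q) _) => [|n _ H].
    move=> q /sub[i _ Piq]; exists (P i, [set n | (i < n)%N]) => /=.
      split; first by apply: open_nbhs_nbhs.
      by exists i.+1.
    by move=> [r n] /= [Pr ni]; exists i.
  by exists n => q; exact: (H n (leqnn n)).
apply: (le_trans (lam_ub phiQ)).
apply: (@le_trans _ _ (\sum_(0 <= i < n) lam (P i))); last first.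
  by apply: nneseries_lim_ge => i _ _.
elim: n {phiQ} => [|n IH].
  by rewrite big_nil /Q bigcup_mkord big_ord0 -clopen_of_Fls lam_clopen mF.
rewrite big_nat_recr//= /Q bigcup_mkord big_ord_recr /= -bigcup_mkord.
apply: (le_trans (lam_setU (oQ n) (oP n))); exact: leeD2r.
Qed.

Definition type_outer (E : set (borel A X)) : \bar R :=
  ereal_inf [set lam P | P in [set P | open P /\ E `<=` P]].

Let outer_le E P : open P -> E `<=` P -> type_outer E <= lam P.
Proof. by move=> oP EP; apply: ereal_inf_lbound; exists P. Qed.

Let le_outer E y : (forall P, open P -> E `<=` P -> y <= lam P) -> y <= type_outer E.
Proof. by move=> H; apply: le_ereal_inf_tmp => _ [P [oP EP] <-]; exact: H. Qed.

Let outer_open P : open P -> type_outer P = lam P.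
Proof.
move=> oP; apply/eqP; rewrite eq_le outer_le//=.
by apply: le_outer => Q _; exact: lam_mono.
Qed.

Let outer_ge0 E : 0 <= type_outer E.
Proof. by apply: le_outer. Qed.

Let outer0 : type_outer set0 = 0.
Proof. by rewrite outer_open ?open0// -clopen_of_Fls lam_clopen mF. Qed.

Let outer_mono : {homo type_outer : E F / E `<=` F >-> E <= F}.
Proof. by move=> E F EF; apply: le_outer => P oP FP; apply: outer_le => // q /EF/FP. Qed.

Let outer_fin E : type_outer E \is a fin_num.
Proof.
rewrite fin_numElt (lt_le_trans _ (outer_ge0 E))//=.
by rewrite (le_lt_trans (outer_le openT (@subsetT _ E)))// lamT ltry.
Qed.

Let outer_approx E (e : R) : (0 < e)%R ->
  exists P, [/\ open P, E `<=` P & lam P <= type_outer E + e%:E].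
Proof.
move=> e0; apply: contrapT => H.
have : type_outer E + e%:E <= type_outer E.
  apply: le_outer => P oP EP; rewrite leNgt; apply/negP => lt; apply: H.
  by exists P; split => //; exact: ltW.
by rewrite -[leRHS]adde0 leeD2lE// lee_fin leNgt e0.
Qed.

Let outer_sigma : sigma_subadditive type_outer.
Proof.
move=> F; apply/lee_addgt0Pr => e e0.
have /choice[P HP] n : exists P, [/\ open P, F n `<=` P &
    lam P <= type_outer (F n) + (e / (2 ^ n.+1)%:R)%:E].
  by apply: outer_approx; rewrite divr_gt0// ltr0n expn_gt0.
have oP n : open (P n) by have [] := HP n.
apply: (@le_trans _ _ (\sum_(i <oo) lam (P i))).
  apply: le_trans (lam_bigcup oP); apply: outer_le; first exact: bigcup_open.
  by apply: subset_bigcup => i _; have [] := HP i.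
apply: le_trans (epsilon_trick xpredT _ (ltW e0)) => //.
by apply: lee_nneseries => // i _; have [] := HP i.
Qed.

HB.instance Definition _ := isOuterMeasure.Build R (borel A X) type_outer
  outer0 outer_ge0 outer_mono outer_sigma.

(** Cover E by an open G. Approximate the intersection of G and P from inside by a clopen [phi],
    then the open set G minus [phi], which covers E minus P, by a clopen [psi]. These are disjoint
    and inside G, so their values add up to at most [lam G]. *)
Let cara_open P : open P -> type_outer.-caratheodory P.
Proof.
move=> oP; apply: le_caratheodory_measurable => E; apply: le_outer => G oG EG.
have H1 : type_outer (E `&` P) <= lam (G `&` P).
  by apply: outer_le; [exact: openI|exact: setSI].
have H3 : type_outer (E `&` ~` P) <= type_outer (G `&` ~` P).
  by apply: outer_mono; exact: setSI.
have := leeD H1 H3; move/le_trans; apply.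
rewrite -leeBrDr//; apply: lam_le => phi sub; rewrite leeBrDr//.
have oD : open (G `\` clopen_of phi).
  by apply: openI => //; apply: closed_openC; exact: clopen_closed.
have H2 : type_outer (G `&` ~` P) <= lam (G `\` clopen_of phi).
  by apply: outer_le => // q [Gq nP]; split=> // /sub[].
apply: (le_trans (leeD2l _ H2)); rewrite addeC -leeBrDr//.
apply: lam_le => psi sub2; rewrite leeBrDr// addeC -EFinD.
pose chi : pformula A X := fnot (fand (fnot phi) (fnot psi)).
have chiE v : psat chi v <-> psat phi v \/ psat psi v.
  change (~ psat (fand (fnot phi) (fnot psi)) v <-> psat phi v \/ psat psi v).
  rewrite psat_fand; split=> [H|[phiv [/(_ phiv)]|psiv [_ /(_ psiv)]]]//.
  by apply: contrapT => /not_orP.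
have dis v : psat phi v -> ~ psat psi v.
  move=> phiv psiv; have [_] := sub2 (tp A v) psiv; exact.
rewrite -(m_add chiE dis); apply: lam_ub.
rewrite clopen_ofC clopen_ofI !clopen_ofC -setCU setCK.
by move=> q [/sub[]|/sub2[]].
Qed.

Let borel_cara (E : set (borel A X)) : measurable E -> type_outer.-caratheodory E.
Proof.
apply: smallest_sub; last by move=> P; exact: cara_open.
exact: (sigma_algebra_measurable (caratheodory_type type_outer)).
Qed.

Definition type_ext (E : set (borel A X)) : \bar R := type_outer E.

Let ext0 : type_ext set0 = 0. Proof. exact: outer0. Qed.
Let ext_ge0 E : 0 <= type_ext E. Proof. exact: outer_ge0. Qed.
Let ext_sigma : semi_sigma_additive type_ext.
Proof.
move=> F mF' tF mUF; apply: caratheodory_measure_sigma_additive => //.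
- by move=> n; exact: (borel_cara (mF' n)).
- exact: (borel_cara mUF).
Qed.

HB.instance Definition _ := isMeasure.Build _ _ _ type_ext ext0 ext_ge0 ext_sigma.

Let extT : type_ext setT = 1.
Proof. by rewrite /type_ext outer_open ?lamT//; exact: openT. Qed.

HB.instance Definition _ := Measure_isProbability.Build _ _ _ type_ext extT.

Let measurable_open (P : set (borel A X)) : @open (ctype A X) P -> measurable P.
Proof. exact: sub_sigma_algebra. Qed.

Let outer_regular (E : set (borel A X)) (e : R) : measurable E -> (0 < e)%R ->
  exists P : set (ctype A X), [/\ open P, E `<=` P & type_ext (P `\` E) < e%:E].
Proof.
move=> mE e0; have e20 : (0 < e / 2)%R by rewrite divr_gt0.
have [P [oP EP le]] := outer_approx E e20; exists P; split => //.
rewrite measureD//; [|exact: measurable_open|by rewrite -ge0_fin_numE//; exact: outer_fin].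
rewrite setIidr// lteBlDr; last exact: outer_fin.
apply: (@le_lt_trans _ _ (type_outer E + (e / 2)%:E)).
  by rewrite -(outer_open oP) in le.
rewrite [X in X < _]addeC.
by rewrite lteD2rE ?lte_fin ?ltr_pdivrMr ?ltr_pMr ?ltr1n//; exact: outer_fin.
Qed.

Let ext_regular : regular type_ext.
Proof.
move=> E mE e e0; have e20 : (0 < e / 2)%R by rewrite divr_gt0.
have [P [oP EP hP]] := outer_regular mE e20.
have [Q [oQ EQ hQ]] := outer_regular (measurableC mE) e20.
exists (~` Q), P; split => //; first exact: open_closedC.
  by move=> q nQ; apply: contrapT => /EQ.
have mPE : measurable ((P : set (borel A X)) `\` E).
  by apply: measurableD => //; exact: measurable_open.
have mQE : measurable ((Q : set (borel A X)) `\` ~` E).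
  by apply: measurableD; [exact: measurable_open|exact: measurableC].
have -> : P `\` ~` Q = (P `\` E) `|` (Q `\` ~` E).
  apply/seteqP; split=> q.
    move=> [Pq /contrapT Qq]; have [|] := pselect (E q); last by left.
    by move=> Eq; right; split=> //; exact.
  by move=> [[Pq nE]|[Qq /contrapT Eq]]; split; [|move=> H; exact/H/EQ|exact: EP|exact].
apply: (le_lt_trans (measureU2 _ mPE mQE)).
by rewrite [e]splitr EFinD; exact: lteD.
Qed.

Lemma keisler_extension :
  exists mu : keisler R A X, forall phi, kval mu phi = m phi.
Proof.
exists (@Keisler R L U A X type_ext ext_regular) => phi.
rewrite /kval /= /type_ext outer_open ?lam_clopen//; exact: open_clopen_of.
Qed.

End Extension.

(** * Values of Keisler measures on formulas *)

Section Kval.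
Variables (R : realType) (L : language) (U : structure L).
Implicit Types A B : set U.

Lemma measurable_clopen_of A X (phi : pformula A X) :
  measurable (clopen_of phi : set (borel A X)).
Proof. by apply: sub_sigma_algebra; exact: open_clopen_of. Qed.

Lemma keisler_fin A X (mu : keisler R A X) (E : set (borel A X)) :
  measurable E -> mu E \is a fin_num.
Proof. by move=> mE; exact: fin_num_measure. Qed.

Lemma kvalE A X (mu : keisler R A X) (phi : pformula A X) :
  (kval mu phi)%:E = mu (clopen_of phi).
Proof. by rewrite fineK// keisler_fin//; exact: measurable_clopen_of. Qed.

Lemma kval_ge0 A X (mu : keisler R A X) (phi : pformula A X) : 0 <= kval mu phi.
Proof. by rewrite fine_ge0. Qed.

Lemma kval_le1 A X (mu : keisler R A X) (phi : pformula A X) : kval mu phi <= 1.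
Proof. by rewrite -lee_fin kvalE probability_le1//; exact: measurable_clopen_of. Qed.

Lemma kval_equiv A X (mu : keisler R A X) (phi psi : pformula A X) :
  (forall v, psat phi v <-> psat psi v) -> kval mu phi = kval mu psi.
Proof. by move=> /clopen_of_equiv E; rewrite /kval E. Qed.

Lemma kval_add A X (mu : keisler R A X) (phi psi chi : pformula A X) :
  (forall v, psat chi v <-> psat phi v \/ psat psi v) ->
  (forall v, psat phi v -> ~ psat psi v) -> kval mu chi = kval mu phi + kval mu psi.
Proof.
move=> chiE dis; have chiE' v : psat chi v <-> psat (fnot (fand (fnot phi) (fnot psi))) v.
  rewrite chiE; change (psat phi v \/ psat psi v <-> ~ psat (fand (fnot phi) (fnot psi)) v).
  rewrite psat_fand; split=> [[phiv [/(_ phiv)]|psiv [_ /(_ psiv)]]|H]//.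
  by apply: contrapT => /not_orP.
rewrite (kval_equiv _ chiE'); apply: EFin_inj; rewrite EFinD !kvalE.
rewrite clopen_ofC clopen_ofI !clopen_ofC -setCU setCK measureU//.
- exact: measurable_clopen_of.
- exact: measurable_clopen_of.
- rewrite -clopen_ofI; apply/seteqP; split=> // q qf.
  have [v /(_ ord0)] := @ctype_finsat _ _ _ _ q 1 (fun=> fand phi psi) (fun=> qf).
  by rewrite psat_fand => -[/dis].
Qed.

Lemma kvalT A X (mu : keisler R A X) (phi : pformula A X) :
  (forall v, psat phi v) -> kval mu phi = 1.
Proof.
move=> H; apply: EFin_inj; rewrite kvalE (_ : clopen_of phi = setT) ?probability_setT//.
apply/seteqP; split=> // q _; apply: contrapT => /ctype_fnot qn.
have [v] := @ctype_finsat _ _ _ _ q 1 (fun=> fnot phi) (fun=> qn).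
by move=> /(_ ord0)/(_ (H v)).
Qed.

Lemma kval0 A X (mu : keisler R A X) (phi : pformula A X) :
  (forall v, ~ psat phi v) -> kval mu phi = 0.
Proof.
move=> H; have E v : psat phi v <-> psat phi v \/ psat phi v.
  by split=> [|[]]; [left| |].
have := kval_add mu E (fun v phiv _ => H v phiv).
by move/(congr1 (fun x => x - kval mu phi)); rewrite subrr addrK.
Qed.

Lemma kval_fnot A X (mu : keisler R A X) (phi : pformula A X) :
  kval mu (fnot phi) = 1 - kval mu phi.
Proof.
have E v : psat (fnot Fls : pformula A X) v <-> psat phi v \/ psat (fnot phi) v.
  by split=> [_|_ []]; have [|] := pselect (psat phi v); [left|right].
have := kval_add mu E (fun v phiv nphi => nphi phiv).
by rewrite (kvalT mu) => [->|v []//]; rewrite addrC addKr.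
Qed.

(* Regularity: a closed set inside E and an open set containing E, taken from
   the two measures, are separated by a clopen set. *)
Lemma kval_keq A X (mu nu : keisler R A X) :
  (forall phi, kval mu phi = kval nu phi) -> keq mu nu.
Proof.
suff le (ka la : keisler R A X) : (forall phi, kval ka phi = kval la phi) ->
    forall E : set (borel A X), measurable E -> (ka E <= la E)%E.
  move=> E F mF; apply/eqP; rewrite eq_le; apply/andP; split; exact: le.
move=> E F mF; apply/lee_addgt0Pr => e e0.
have e20 : 0 < e / 2 by rewrite divr_gt0.
have [C [P [cC oP CF FP PC]]] := kregular ka mF e20.
have [D [Q [cD oQ DF FQ QD]]] := kregular la mF e20.
have mcl (G : set (ctype A X)) : closed G -> measurable (G : set (borel A X)).
  move=> cG; rewrite -[G]setCK; apply: measurableC; apply: sub_sigma_algebra.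
  exact: closed_openC.
have mop (G : set (ctype A X)) : open G -> measurable (G : set (borel A X)).
  exact: sub_sigma_algebra.
have [phi [Cphi phiQ]] := clopen_between cC oQ (subset_trans CF FQ).
have mC := mcl _ cC; have mQ := mop _ oQ; have mphi := measurable_clopen_of phi.
have H1 : (ka F <= ka C + (e / 2)%:E)%E.
  rewrite -[X in ka X](setDUK CF); apply: (le_trans (measureU2 _ _ _)) => //.
    exact: measurableD.
  apply: leeD2l; apply: le_trans (ltW PC); apply: le_measure; rewrite ?inE.
  - exact: measurableD.
  - by apply: measurableD => //; exact: mop.
  - exact: setSD.
have H2 : (la Q <= la F + (e / 2)%:E)%E.
  rewrite -[X in la X](setDUK FQ); apply: (le_trans (measureU2 _ _ _)) => //.
    exact: measurableD.
  apply: leeD2l; apply: le_trans (ltW QD); apply: le_measure; rewrite ?inE.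
  - exact: measurableD.
  - by apply: measurableD => //; exact: mcl.
  - by apply: setDS.
rewrite [e in leRHS]splitr EFinD addeA; apply: (le_trans H1); apply: leeD2r.
apply: le_trans H2; apply: (@le_trans _ _ (ka (clopen_of phi))).
  by apply: le_measure; rewrite ?inE.
by rewrite -kvalE E kvalE; apply: le_measure; rewrite ?inE.
Qed.

Lemma kval_kpush A B V W (f : V -> W) (AB : A `<=` B) (mu : keisler R B W) phi :
  kval (kpush f AB mu) phi = kval mu (prename f AB phi).
Proof. by []. Qed.

End Kval.

(** * Integration of bounded Borel functions *)

Section Integration.
Variables (R : realType) (L : language) (U : structure L).
Implicit Types A B : set U.

Definition kint A Y (nu : keisler R A Y) (f : ctype A Y -> R) : R :=
  \int[nu]_(q in [set: borel A Y]) f q.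

Definition bounded_borel A Y (f : ctype A Y -> R) :=
  measurable_fun setT (f : borel A Y -> R) /\ exists c, forall q, `|f q| <= c.

Section Fixed.
Variables (A : set U) (Y : Type) (nu : keisler R A Y).
Implicit Types f g h : ctype A Y -> R.

Lemma bounded_borel_integrable f : bounded_borel f ->
  nu.-integrable [set: borel A Y] (EFin \o f).
Proof.
move=> [mf [c fc]]; apply: measurable_bounded_integrable => //.
  exact: (le_lt_trans (probability_le1 nu measurableT) (ltry _)).
by exists c; split=> [|x cx q _ /=]; [exact: num_real|exact: le_trans (fc q) (ltW cx)].
Qed.

Lemma bounded_borel_cst (c : R) : bounded_borel (fun _ : ctype A Y => c).
Proof. by split; [exact: measurable_cst|exists `|c|]. Qed.

Lemma bounded_borelD f g : bounded_borel f -> bounded_borel g ->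
  bounded_borel (fun q => f q + g q).
Proof.
move=> [mf [c fc]] [mg [d gd]]; split; first exact: measurable_funD.
by exists (c + d) => q; apply: le_trans (ler_normD _ _) _; exact: lerD.
Qed.

Lemma bounded_borelZ (c : R) f : bounded_borel f -> bounded_borel (fun q => c * f q).
Proof.
move=> [mf [d fd]]; split; first by apply: measurable_funM => //; exact: measurable_cst.
by exists (`|c| * d) => q; rewrite normrM ler_wpM2l.
Qed.

Lemma bounded_borel_sum (I : Type) (s : seq I) (f : I -> ctype A Y -> R) :
  (forall i, bounded_borel (f i)) -> bounded_borel (fun q => \sum_(i <- s) f i q).
Proof.
move=> bf; elim: s => [|i s IH].
  by under eq_fun do rewrite big_nil; exact: bounded_borel_cst.
by under eq_fun do rewrite big_cons; exact: bounded_borelD.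
Qed.

Lemma bounded_borel_clopen (phi : pformula A Y) :
  bounded_borel (fun q : ctype A Y => `[< q phi >]%:R).
Proof.
split; last by exists 1 => q; case: asbool; rewrite ?normr1// normr0.
rewrite (_ : (fun _ => _) = \1_(clopen_of phi : set (borel A Y))).
  exact: measurable_indic (measurable_clopen_of phi).
by apply/funext => q; rewrite indicE.
Qed.

Lemma kint_cst (c : R) : kint nu (fun=> c) = c.
Proof.
rewrite /kint Rintegral_cst// -[RHS]mulr1; congr (_ * _).
exact: (congr1 fine (probability_setT nu)).
Qed.

Lemma kintD f g : bounded_borel f -> bounded_borel g ->
  kint nu (fun q => f q + g q) = kint nu f + kint nu g.
Proof. by move=> bf bg; rewrite /kint RintegralD//; exact: bounded_borel_integrable. Qed.

Lemma kintZ (c : R) f : bounded_borel f -> kint nu (fun q => c * f q) = c * kint nu f.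
Proof. by move=> bf; rewrite /kint RintegralZl//; exact: bounded_borel_integrable. Qed.

Lemma kint_sum (I : Type) (s : seq I) (f : I -> ctype A Y -> R) :
  (forall i, bounded_borel (f i)) ->
  kint nu (fun q => \sum_(i <- s) f i q) = \sum_(i <- s) kint nu (f i).
Proof.
move=> bf; elim: s => [|i s IH].
  by under eq_fun do rewrite big_nil; rewrite kint_cst big_nil.
under eq_fun do rewrite big_cons; rewrite big_cons -IH kintD//.
exact: bounded_borel_sum.
Qed.

Lemma kint_le f g : bounded_borel f -> bounded_borel g ->
  (forall q, f q <= g q) -> kint nu f <= kint nu g.
Proof.
by move=> bf bg fg; apply: le_Rintegral => //; exact: bounded_borel_integrable.
Qed.

Lemma kint_dist f g h : bounded_borel f -> bounded_borel g -> bounded_borel h ->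
  (forall q, `|f q - g q| <= h q) -> `|kint nu f - kint nu g| <= kint nu h.
Proof.
move=> bf bg bh fgh; rewrite ler_distlC; apply/andP; split.
  rewrite lerBlDr -kintD//; apply: kint_le => //; first exact: bounded_borelD.
  by move=> q; have := fgh q; rewrite ler_distlC lerBlDr => /andP[].
rewrite -kintD//; apply: kint_le => //; first exact: bounded_borelD.
by move=> q; have := fgh q; rewrite ler_distlC => /andP[].
Qed.

Lemma kint_clopen (phi : pformula A Y) :
  kint nu (fun q => `[< q phi >]%:R) = kval nu phi.
Proof.
rewrite /kint /Rintegral /kval; congr fine.
rewrite -[X in nu X]setIT -integral_indic//; exact: measurable_clopen_of.
Qed.

Lemma eq_kint f g : f =1 g -> kint nu f = kint nu g.
Proof. by move=> /funext ->. Qed.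

End Fixed.

Lemma kint_keq A Y (mu nu : keisler R A Y) f : keq mu nu -> kint mu f = kint nu f.
Proof.
move=> E; rewrite /kint /Rintegral; congr fine.
by apply: eq_measure_integral => S mS _; exact: E.
Qed.

Lemma bounded_borel_tpull A B V W (f : V -> W) (AB : A `<=` B) (g : ctype A V -> R) :
  bounded_borel g -> bounded_borel (fun q : ctype B W => g (tpull f AB q)).
Proof.
move=> [mg [c gc]]; split; last by exists c.
exact: (measurableT_comp mg (@measurable_tpull L U A B V W f AB)).
Qed.

Lemma kint_kpush A B V W (f : V -> W) (AB : A `<=` B) (mu : keisler R B W)
    (g : ctype A V -> R) : bounded_borel g ->
  kint (kpush f AB mu) g = kint mu (fun q => g (tpull f AB q)).
Proof.
move=> bg; rewrite /kint /Rintegral; congr fine.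
have mt := @measurable_tpull L U A B V W f AB.
have := @integral_pushforward _ _ (borel B W) (borel A V) R _ mt mu setT (EFin \o g).
rewrite preimage_setT; apply => //.
- by apply/measurable_EFinP; case: bg.
- exact: bounded_borel_integrable (bounded_borel_tpull f AB bg).
Qed.

End Integration.

(** * Generic values of invariant functions *)

Section Invariance.
Variables (R : realType) (L : language) (U : structure L).
Implicit Types A B : set U.

(** The parameters of [phi] join the tuple b, so phi(x,b) becomes psi(x;b,c) with [psi] free of
    parameters. Invariance, Borel definability and fim, each stated over one base set, thereby reach
    formulas over other sets. *)
Lemma inst_finite_params B X Y (phi : pformula B (X + Y)) :
  exists (W : finType) (c : W -> B) (psi : formula L (X + (Y + W))),
    forall A (b : Y -> U) v, psat (inst phi b) v <->
      psat (inst (pure A psi) (pair_assign b (val \o c))) v.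
Proof.
have [W [c [psi psiE]]] := pformula_finite_params phi.
pose f (z : (X + Y) + W) : X + (Y + W) := match z with
  | inl (inl x) => inl x | inl (inr y) => inr (inl y) | inr w => inr (inr w) end.
exists W, c, (rename f psi) => A b v.
rewrite !psat_inst psat_pure sat_rename psiE.
set v1 := pair_assign _ _; set v2 := _ \o f.
by suff -> : v1 = v2 by []; apply/funext => -[[]|].
Qed.

(** The parameters c lie in B, so b and b' having the same type over B makes bc and b'c have the
    same type over A. *)
Lemma invariant_inst A B X (Y : finType) (mu : gkeisler R U X)
    (phi : pformula B (X + Y)) (b b' : Y -> U) :
  invariant_over A mu -> A `<=` B -> equiv_over B b b' ->
  kval mu (inst phi b) = kval mu (inst phi b').
Proof.
move=> inv AB E; have [W [c [psi psiE]]] := inst_finite_params phi.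
rewrite (kval_equiv mu (psiE A b)) (kval_equiv mu (psiE A b')).
apply: inv; exact: equiv_over_params.
Qed.

Lemma inst_globalize B X Y (mu : gkeisler R U X) (phi : pformula B (X + Y)) b :
  kval mu (inst (globalize phi) b) = kval mu (inst phi b).
Proof. by apply: kval_equiv => v; rewrite !psat_inst psat_globalize. Qed.

Lemma inst_equiv A B X Y (mu : gkeisler R U X) (phi : pformula A (X + Y))
    (psi : pformula B (X + Y)) b :
  (forall v, psat phi v <-> psat psi v) ->
  kval mu (inst phi b) = kval mu (inst psi b).
Proof. by move=> E; apply: kval_equiv => v; rewrite !psat_inst E. Qed.

Lemma fiberE A B X (Y : finType) (mu : gkeisler R U X) (phi : pformula B (X + Y))
    (q : ctype B Y) (b : Y -> U) :
  invariant_over A mu -> A `<=` B -> realizes b q ->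
  fiber mu phi q = kval mu (inst phi b).
Proof.
move=> inv AB bq; rewrite /fiber; apply: xget_unique; first by exists b.
move=> _ [b' b'q ->]; apply: (invariant_inst _ inv AB).
exact: realizes_equiv b'q bq.
Qed.

End Invariance.

Section GenericValue.
Variables (R : realType) (L : language) (U : structure L) (K : Type).
Hypotheses (Kinf : infinite_set [set: K]) (satU : saturated U K).
Implicit Types A B : set U.

Definition ctype_restrict B Y (q : ctype [set: U] Y) : ctype B Y :=
  tpull id (@subsetT _ B) q.

Lemma ctype_restrictE B Y (q : ctype [set: U] Y) (phi : pformula B Y) :
  ctype_restrict B q phi <-> q (globalize phi).
Proof. by []. Qed.

Lemma realizes_restrictS A B Y (q : ctype [set: U] Y) b : A `<=` B ->
  realizes b (ctype_restrict B q) -> realizes b (ctype_restrict A q).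
Proof.
move=> AB bq phi /ctype_restrictE qphi; rewrite -(psat_prename id AB).
apply: bq; apply/ctype_restrictE; move: qphi; apply: ctype_imp => v.
by rewrite !psat_globalize psat_prename.
Qed.

Definition small_invariant Y (F : (Y -> U) -> R) :=
  exists2 B, small K B & forall b b', equiv_over B b b' -> F b = F b'.

(* The common value of F at the realizations of q over any small set over
   which F is invariant. *)
Definition generic_value Y (F : (Y -> U) -> R) (q : ctype [set: U] Y) : R :=
  xget 0 [set r | exists2 B, small K B &
    forall b, realizes b (ctype_restrict B q) -> F b = r].

(** Two candidate values agree at a realization of q over the union of the two small sets, which
    saturation supplies. *)
Lemma generic_valueE B (Y : finType) (F : (Y -> U) -> R) q b : small K B ->
  (forall b b', equiv_over B b b' -> F b = F b') ->
  realizes b (ctype_restrict B q) -> generic_value F q = F b.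
Proof.
move=> sB inv bq; apply: xget_unique.
  by exists B => // b' b'q; apply: inv; exact: realizes_equiv b'q bq.
move=> r [B' sB' H].
have [b' b'q] := satU (smallU Kinf sB sB') (ctype_restrict (B `|` B') q).
have b'B : realizes b' (ctype_restrict B q).
  by apply: realizes_restrictS b'q => x; left.
rewrite -(H b'); last by apply: realizes_restrictS b'q => x; right.
by apply: inv; exact: realizes_equiv b'B bq.
Qed.

Lemma generic_value_realized B (Y : finType) (F : (Y -> U) -> R) q :
  small K B -> small_invariant F ->
  exists2 b, realizes b (ctype_restrict B q) & generic_value F q = F b.
Proof.
move=> sB [C sC CF]; have sE := smallU Kinf sB sC.
have [b bq] := satU sE (ctype_restrict (B `|` C) q); exists b.
  by apply: realizes_restrictS bq => x; left.
by apply: (generic_valueE sC CF); apply: realizes_restrictS bq => x; right.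
Qed.

Lemma generic_valueD (Y : finType) (F G : (Y -> U) -> R) q :
  small_invariant F -> small_invariant G ->
  generic_value (fun b => F b + G b) q = generic_value F q + generic_value G q.
Proof.
move=> [C sC CF] [D sD DG]; have sE := smallU Kinf sC sD.
have [b bq] := satU sE (ctype_restrict (C `|` D) q).
have bC : realizes b (ctype_restrict C q).
  by apply: realizes_restrictS bq => x; left.
have bD : realizes b (ctype_restrict D q).
  by apply: realizes_restrictS bq => x; right.
rewrite (generic_valueE sC CF bC) (generic_valueE sD DG bD).
apply: (generic_valueE sE _ bq) => c c' cc'.
by rewrite (CF c c') ?(DG c c')//; apply: equiv_overS cc' => x; [right|left].
Qed.

Lemma invariant_small_inst A X (Y : finType) (mu : gkeisler R U X)
    (phi : pformula [set: U] (X + Y)) : small K A -> invariant_over A mu ->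
  small_invariant (fun b => kval mu (inst phi b)).
Proof.
move=> sA inv; have [B [psi [AB sB psiE]]] := globalize_small phi Kinf sA.
exists B => // b b' bb'.
have E := inst_equiv mu _ (fun v => iff_trans (iff_sym (psiE v)) (psat_globalize psi v)).
by rewrite !E; exact: invariant_inst inv AB bb'.
Qed.

(** Lifts the fiber from S(B), a space that changes with B, to the single space S(U). *)
Lemma generic_fiber A B X (Y : finType) (mu : gkeisler R U X)
    (phi : pformula B (X + Y)) q : small K B -> invariant_over A mu -> A `<=` B ->
  generic_value (fun b => kval mu (inst (globalize phi) b)) q =
  fiber mu phi (ctype_restrict B q).
Proof.
move=> sB inv AB; have [b bq] := satU sB (ctype_restrict B q).
rewrite (fiberE phi inv AB bq) -inst_globalize.
apply: (generic_valueE sB _ bq) => c c' cc'; rewrite !inst_globalize.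
exact: invariant_inst inv AB cc'.
Qed.

Lemma fiber_ge0_le1 A B X (Y : finType) (mu : gkeisler R U X)
    (phi : pformula B (X + Y)) q : small K B -> invariant_over A mu -> A `<=` B ->
  0 <= fiber mu phi q <= 1.
Proof.
move=> sB inv AB; have [b bq] := satU sB q.
by rewrite (fiberE phi inv AB bq) kval_ge0 kval_le1.
Qed.

(** Borel definability is a condition on formulas over A. A fiber over a larger B is a fiber over A
    composed with the continuous map [add_params]. *)
Lemma bounded_borel_fiber A B X (Y : finType) (mu : gkeisler R U X)
    (phi : pformula B (X + Y)) : borel_definable_over K A mu -> A `<=` B ->
  small K B -> bounded_borel (fiber mu phi).
Proof.
move=> [sA inv meas] AB sB; split; last first.
  exists 1 => q; have /andP[? ?] := fiber_ge0_le1 phi q sB inv AB.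
  by rewrite ger0_norm.
have [W [c [psi psiE]]] := inst_finite_params phi.
have -> : fiber mu phi =
    fun q => fiber mu (pure A psi) (add_params c AB q).
  apply/funext => q; have [b bq] := satU sB q.
  rewrite (fiberE phi inv AB bq) (kval_equiv mu (psiE A b)).
  by rewrite (fiberE _ inv (@subset_refl _ A) (@realizes_add_params _ _ _ _ _ _ c AB _ _ bq)).
have ma := @measurable_add_params L U A B Y W c AB.
have mf := meas (Y + W)%type (pure A psi).
exact: (measurableT_comp mf ma).
Qed.

Lemma bounded_borel_generic X (Y : finType) (mu : gkeisler R U X)
    (phi : pformula [set: U] (X + Y)) : borel_definable K mu ->
  bounded_borel (generic_value (fun b => kval mu (inst phi b))).
Proof.
move=> [A defA]; have [sA inv _] := defA.
have [B [psi [AB sB psiE]]] := globalize_small phi Kinf sA.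
have -> : (fun b => kval mu (inst phi b)) =
    (fun b => kval mu (inst (globalize psi) b)).
  by apply/funext => b; apply: inst_equiv => v; rewrite psiE.
rewrite (_ : generic_value _ = fun q => fiber mu psi (ctype_restrict B q)).
  exact: bounded_borel_tpull (bounded_borel_fiber psi defA AB sB).
by apply/funext => q; exact: generic_fiber inv AB.
Qed.

Lemma generic_value_cst (Y : finType) (F : (Y -> U) -> R) (q : ctype [set: U] Y) r :
  (forall b, F b = r) -> generic_value F q = r.
Proof.
have sF : small K (set0 : set U) by apply: finite_small => //; exact: finite_set0.
move=> H; have [b bq] := satU sF (ctype_restrict _ q).
by rewrite (generic_valueE sF _ bq) => // c c' _; rewrite !H.
Qed.

Section MorleyExists.
Variables (X Y : finType).

(** The integral of the generic value over S(U) treats all global formulas at once and is finitely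
    additive in them; the defining equation over each B then follows by change of variables along
    restriction of types. *)
Lemma morley_exists (mu : gkeisler R U X) (nu : gkeisler R U Y) :
  borel_definable K mu -> exists omega : gkeisler R U (X + Y),
    is_morley K mu nu omega /\ forall phi, kval omega phi =
      kint nu (generic_value (fun b => kval mu (inst phi b))).
Proof.
move=> defmu; have [A [sA inv _]] := defmu.
have si (phi : pformula [set: U] (X + Y)) := invariant_small_inst phi sA inv.
have bb (phi : pformula [set: U] (X + Y)) := bounded_borel_generic phi defmu.
have ge0 (phi : pformula [set: U] (X + Y)) :
    0 <= kint nu (generic_value (fun b => kval mu (inst phi b))).
  have H := kint_le nu (bounded_borel_cst _ _ 0) (bb phi).
  rewrite kint_cst in H; apply: H => q.
  have [b _ ->] := generic_value_realized q sA (si phi).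
  exact: kval_ge0.
have [||omega omegaE] := keisler_extension ge0.
- rewrite -[RHS](kint_cst nu); apply: eq_kint => q; apply: generic_value_cst => b.
  by apply: kvalT => v; rewrite psat_inst.
- move=> phi psi chi chiE dis; rewrite -(kintD _ (bb phi) (bb psi)); apply: eq_kint => q.
  rewrite -(generic_valueD _ (si phi) (si psi)); congr generic_value; apply/funext => b.
  apply: kval_add => v; rewrite !psat_inst; [exact: chiE|exact: dis].
exists omega; split=> // A' B [sA' inv' meas'] AB sB phi.
have bf := bounded_borel_fiber phi (And3 sA' inv' meas') AB sB.
rewrite omegaE; transitivity (kint (Defs.restrict B nu) (fiber mu phi))%:E.
  congr EFin; rewrite (kint_kpush _ _ _ bf); apply: eq_kint => q.
  exact: generic_fiber inv' AB.
rewrite /kint /Rintegral fineK//; apply: integrable_fin_num => //.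
exact: bounded_borel_integrable.
Qed.

End MorleyExists.
End GenericValue.

(** * Morley products, their powers, and definability of fim measures *)

Section MorleyProducts.
Variables (R : realType) (L : language) (U : structure L) (K : Type).
Hypotheses (Kinf : infinite_set [set: K]) (satU : saturated U K).
Implicit Types A B M : set U.

(** [morley] is picked by choice, but any two measures with the defining equations agree on a
    formula, by the equation over a small set that contains its parameters. *)
Lemma kval_morley (X Y : finType) (mu : gkeisler R U X) (nu : gkeisler R U Y) phi :
  borel_definable K mu -> kval (morley K mu nu) phi =
    kint nu (generic_value K (fun b => kval mu (inst phi b))).
Proof.
move=> [A defA]; have [sA inv _] := defA.
have [omega [omegaP omegaE]] := morley_exists Kinf satU nu (ex_intro _ A defA).
have morP : is_morley K mu nu (morley K mu nu).
  by apply: (@getPex _ [set omega | is_morley K mu nu omega]); exists omega.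
have [B [psi [AB sB psiE]]] := globalize_small phi Kinf sA.
rewrite -omegaE -!(kval_equiv _ psiE); apply: EFin_inj.
by rewrite (omegaP _ _ defA AB sB) (morP _ _ defA AB sB).
Qed.

(** Evaluation at p takes the place of the integral, which is why invariance of nu suffices where
    [kval_morley] asks for Borel definability. *)
Lemma kval_morley_type (X Y : finType) (nu : gkeisler R U Y)
    (p : ctype [set: U] X) phi : invariant_measure K nu ->
  kval (morley_type K nu p) phi =
    generic_value K (fun a => kval nu (inst phi a)) p.
Proof.
move=> [A sA inv].
have si (chi : pformula [set: U] (Y + X)) := invariant_small_inst Kinf chi sA inv.
have ge0 (chi : pformula [set: U] (Y + X)) :
    0 <= generic_value K (fun a => kval nu (inst chi a)) p.
  by have [b _ ->] := generic_value_realized Kinf satU p sA (si chi); exact: kval_ge0.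
have [||omega omegaE] := keisler_extension ge0.
- by apply: generic_value_cst => // b; apply: kvalT => v; rewrite psat_inst.
- move=> phi1 phi2 chi chiE dis; rewrite -(generic_valueD Kinf satU _ (si _) (si _)).
  congr generic_value; apply/funext => b.
  by apply: kval_add => v; rewrite !psat_inst; [exact: chiE|exact: dis].
have omegaP : is_morley_type K nu p omega.
  move=> C B sC invC CB sB psi a ap; rewrite omegaE -inst_globalize.
  apply: (generic_valueE Kinf satU sB _ ap) => c c' cc'; rewrite !inst_globalize.
  exact: invariant_inst invC CB cc'.
have morP : is_morley_type K nu p (morley_type K nu p).
  by apply: (@getPex _ [set omega | is_morley_type K nu p omega]); exists omega.
have [B [psi [AB sB psiE]]] := globalize_small phi Kinf sA.
have [a ap] := satU sB (ctype_restrict B p).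
rewrite -omegaE -!(kval_equiv _ psiE).
by rewrite (omegaP _ _ sA inv AB sB _ _ ap) (morP _ _ sA inv AB sB _ _ ap).
Qed.

Section Marginals.
Variables (X Y : finType) (mu : gkeisler R U X) (nu : gkeisler R U Y).
Hypothesis defmu : borel_definable K mu.

Lemma kval_morley_inl phi :
  kval (morley K mu nu) (prename inl (@subset_refl _ setT) phi) = kval mu phi.
Proof.
rewrite kval_morley// -[RHS](kint_cst nu); apply: eq_kint => q.
apply: generic_value_cst => // b; apply: kval_equiv => v.
by rewrite psat_inst psat_prename.
Qed.

(** The formula does not involve x, so its mu-value at b is 1 or 0 according to the truth of phi(b),
    and its generic value is the indicator of [clopen_of phi]. *)
Lemma kval_morley_inr phi :
  kval (morley K mu nu) (prename inr (@subset_refl _ setT) phi) = kval nu phi.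
Proof.
rewrite kval_morley// -kint_clopen; apply: eq_kint => q.
have [A [sA inv _]] := defmu.
have [B [psi [AB sB psiE]]] := globalize_small phi Kinf sA.
have [b bq ->] := generic_value_realized Kinf satU q sB
  (invariant_small_inst Kinf (prename inr (@subset_refl _ setT) phi) sA inv).
have qE : q phi <-> psat phi b.
  rewrite -(ctype_equiv q psiE) -ctype_restrictE (realizesE _ bq).
  by rewrite -psat_globalize psiE.
have [phib|nphib] := pselect (psat phi b).
  by rewrite asboolT ?qE// kvalT// => v; rewrite psat_inst psat_prename.
by rewrite asboolF ?qE// kval0// => v; rewrite psat_inst psat_prename.
Qed.

End Marginals.

(** The last block is the left factor of the product; every other block is a block of the right
    factor, to which induction applies. *)
Lemma kval_power (X : finType) (mu : gkeisler R U X) : borel_definable K mu ->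
  forall n (i : 'I_n.+1) phi,
  kval (power K mu n) (prename (pair i) (@subset_refl _ setT) phi) = kval mu phi.
Proof.
move=> defmu; elim=> [|n IH] i phi.
  by rewrite kval_kpush; apply: kval_equiv => v; rewrite !psat_prename.
rewrite kval_kpush.
have [j ij|imax] := unliftP ord_max i.
  rewrite -(IH j phi) -(kval_morley_inr (power K mu n) defmu).
  apply: kval_equiv => v; rewrite !psat_prename.
  set v1 := (X in psat phi X <-> _); set v2 := (X in _ <-> psat phi X).
  suff -> : v1 = v2 by [].
  by apply/funext => x; rewrite /v1 /v2 /= /split_last /= ij liftK.
rewrite -(kval_morley_inl (power K mu n) defmu phi).
apply: kval_equiv => v; rewrite !psat_prename.
set v1 := (X in psat phi X <-> _); set v2 := (X in _ <-> psat phi X).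
suff -> : v1 = v2 by [].
by apply/funext => x; rewrite /v1 /v2 /= /split_last /= imax unlift_none.
Qed.

Lemma power_marginal (X : finType) (mu : gkeisler R U X) n (i : 'I_n.+1) :
  borel_definable K mu ->
  keq (kpush (pair i) (@subset_refl _ setT) (power K mu n)) mu.
Proof. by move=> defmu; apply: kval_keq => phi; rewrite kval_kpush kval_power. Qed.

End MorleyProducts.

(** * Definability of fim measures *)

Section FimDefinability.
Variables (R : realType) (L : language) (U : structure L) (K : Type).
Hypotheses (Kinf : infinite_set [set: K]) (satU : saturated U K).

Definition fim_over (X : Type) (mu : gkeisler R U X) (M : set U) :=
  forall (Y : finType) (phi : formula L (X + Y)),
  exists theta : forall n, pformula M ('I_n.+1 * X),
  [/\ forall n, exists a, psat (theta n) a,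
      forall eps : R, 0 < eps -> exists N : nat, forall n, (N <= n)%N ->
        forall a, psat (theta n) a -> forall b : Y -> U,
        `| kval mu (inst (pure M phi) b) - average R phi a b | < eps &
      (fun n => kval (power K mu n) (globalize (theta n))) @ \oo --> (1 : R)].

Variables (X : finType) (mu : gkeisler R U X) (M : set U).
Hypothesis fimM : fim_over mu M.

(* Besides theta_n, the formula chi records the truth values of phi(a_i,b). *)
Let fim_local_pure (Y : finType) (phi : formula L (X + Y)) (b : Y -> U) eps :
  0 < eps -> exists2 chi : pformula M Y, psat chi b & forall b', psat chi b' ->
    `|kval mu (inst (pure M phi) b) - kval mu (inst (pure M phi) b')| < eps.
Proof.
move=> eps0; have [theta [ex H _]] := fimM phi.
have [|n /(_ n (leqnn n)) {}H] := H (eps / 2); first by rewrite divr_gt0.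
have [a thetaa] := ex n.
pose s (i : 'I_n.+1) (a : 'I_n.+1 * X -> U) (b : Y -> U) :=
  sat phi (pair_assign (fun x => a (i, x)) b).
pose D (v : ('I_n.+1 * X) + Y -> U) := psat (theta n) (v \o inl) /\
  forall i, s i (v \o inl) (v \o inr) <-> s i a b.
(* The tuple [a] need not lie in M. Quantifying it away leaves only parameters from M, and any [a']
   with the same truth pattern serves equally well, since it too satisfies [theta n]. *)
have : definable M [set b' | exists a', D (pair_assign a' b')].
  apply: definable_exists_fin; apply: definableI.
    by apply: (@definable_subst _ _ _ _ _ inl (psat (theta n))); exists (theta n).
  apply: definable_forall_ord => i.
  pose f (z : X + Y) : ('I_n.+1 * X) + Y :=
    match z with inl x => inl (i, x) | inr y => inr y end.
  have ds : definable M [set v : ('I_n.+1 * X) + Y -> U | s i (v \o inl) (v \o inr)].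
    have := @definable_subst _ _ M _ _ f (sat phi : set _).
    have dphi : definable M (sat phi : set (_ -> U)).
      by exists (pure M phi) => v; exact: psat_pure.
    move=> /(_ dphi); congr definable; apply/funext => v /=; rewrite /s.
    by congr (sat phi _); apply/funext => -[].
  have [sb|nsb] := pselect (s i a b).
    by move: ds; congr definable; apply/seteqP; split=> v /= => [|->].
  move: (definableC ds); congr definable; apply/seteqP; split=> v /=.
    by move=> ns; split=> // /nsb.
  by move=> E /E.
move=> [chi chiE]; exists chi.
  apply/chiE; exists a; split=> // i; exact: iff_refl.
move=> b' /chiE[a' [thetaa' E]].
have -> : eps = eps / 2 + eps / 2 by rewrite -splitr.
(* Equal truth patterns give equal averages, so both values of mu lie within eps / 2 of one
   number. *)
have avg : average R phi a b = average R phi a' b'.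
  congr (_ * _); apply: eq_bigr => i _; congr (_%:R); congr (nat_of_bool _).
  by apply: asbool_equiv_eq; apply: iff_sym; exact: E.
apply: le_lt_trans (ler_distD (average R phi a b) _ _) _.
apply: ltrD; first exact: H.
by rewrite distrC avg; exact: H.
Qed.

Let fim_local (Y : finType) (phi : pformula M (X + Y)) (b : Y -> U) eps :
  0 < eps -> exists2 chi : pformula M Y, psat chi b & forall b', psat chi b' ->
    `|kval mu (inst phi b) - kval mu (inst phi b')| < eps.
Proof.
move=> eps0; have [W [c [psi psiE]]] := inst_finite_params phi.
have [chi chib H] := fim_local_pure psi (pair_assign b (val \o c)) eps0.
exists (formula_params c chi (@subset_refl _ M)).
  by rewrite psat_formula_params.
move=> b'; rewrite psat_formula_params => /H.
by rewrite (kval_equiv mu (psiE M b)) (kval_equiv mu (psiE M b')).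
Qed.

Lemma fim_invariant : invariant_over M mu.
Proof.
move=> Y phi b b' bb'; apply/eqP; rewrite -subr_eq0 -normr_le0.
apply/ler_addgt0Pl => eps eps0; rewrite addr0; apply: ltW.
have [chi chib] := fim_local phi b eps0; apply; exact/bb'.
Qed.

(** By [fim_local] the sets where the fiber exceeds r are open, and half-lines generate the Borel
    sets of the reals. Saturation allows types to be replaced by realizations, for which the local
    estimate is stated. *)
Lemma fim_borel_definable : small K M -> borel_definable_over K M mu.
Proof.
move=> sM; split=> //; first exact: fim_invariant.
move=> Y phi; apply: (measurability _ (RGenOInfty.measurableE R)).
move=> _ [_ [r ->] <-]; rewrite setTI; apply: sub_sigma_algebra.
rewrite openE_ctype => q /=; rewrite in_itv /= andbT => rq.
have [b bq] := satU sM q.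
have fE c c' := fiberE phi fim_invariant (@subset_refl _ M) (q := c) (b := c').
have e0 : 0 < fiber mu phi q - r by rewrite subr_gt0.
have [chi chib H] := fim_local phi b e0; exists chi; first exact/(realizesE _ bq).
move=> q' q'chi /=; rewrite in_itv /= andbT.
have [b' b'q'] := satU sM q'.
have := H b' (b'q' _ q'chi); rewrite (fE _ _ bq) (fE _ _ b'q').
by rewrite ltr_distlC => /andP[h1 h2]; lra.
Qed.

End FimDefinability.

(** * Commutation *)

Section Commutation.
Variables (R : realType) (L : language) (U : structure L) (K : Type).
Hypotheses (Kinf : infinite_set [set: K]) (satU : saturated U K).
Implicit Types A B M : set U.

(** Links integrands that read off membership of the [chi i] in a global type to truth at a tuple of
    U. *)
Lemma small_realizes_formulas (Y : finType) n (chi : 'I_n -> pformula [set: U] Y) B :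
  small K B -> exists C, [/\ B `<=` C, small K C &
    forall q b, realizes b (ctype_restrict C q) ->
      forall i, q (chi i) <-> psat (chi i) b].
Proof.
elim: n chi => [|n IH] chi sB.
  by exists B; split=> // q b _ [].
have [C [BC sC HC]] := IH (fun i => chi (lift ord0 i)) sB.
have [D [psi [CD sD psiE]]] := globalize_small (chi ord0) Kinf sC.
exists D; split=> //; first exact: subset_trans CD.
move=> q b bq i; have [j ->|->] := unliftP ord0 i.
  by apply: HC; exact: realizes_restrictS bq.
rewrite -(ctype_equiv q psiE) -psiE psat_globalize.
by rewrite -ctype_restrictE (realizesE _ bq).
Qed.

Lemma realizes_tpull B V W (f : V -> W) (q : ctype [set: U] W) a :
  realizes a (ctype_restrict B q) ->
  realizes (a \o f) (ctype_restrict B (tpull f (@subset_refl _ setT) q)).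
Proof.
move=> aq phi; rewrite -(psat_prename f (@subset_refl _ B)) => H; apply: aq.
have {}H : q (prename f (@subset_refl _ setT) (globalize phi)) by [].
apply/ctype_restrictE; move: H; apply: ctype_imp => v.
by rewrite psat_globalize !psat_prename.
Qed.

Definition swap_formula (X Y : Type) (phi : pformula [set: U] (X + Y)) :
    pformula [set: U] (Y + X) :=
  prename (@sum_swap X Y) (@subset_refl _ setT) phi.

Lemma psat_swap X Y (phi : pformula [set: U] (X + Y)) (a : X -> U) (b : Y -> U) :
  psat (swap_formula phi) (pair_assign b a) <-> psat phi (pair_assign a b).
Proof.
rewrite psat_prename; set v := _ \o _.
by suff -> : v = pair_assign a b by []; apply/funext => -[].
Qed.

Lemma mean_cst n (r : R) : n.+1%:R^-1 * \sum_(i < n.+1) r = r.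
Proof. by rewrite sumr_const card_ord -[r *+ _]mulr_natl mulKf// pnatr_eq0. Qed.

Definition mean_kval (X Y : finType) (nu : gkeisler R U Y)
    (phi : pformula [set: U] (X + Y)) n (a : 'I_n.+1 * X -> U) : R :=
  n.+1%:R^-1 *
    \sum_(i < n.+1) kval nu (inst (swap_formula phi) (fun x => a (i, x))).

Section FimMean.
Variables (X Y : finType) (mu : gkeisler R U X) (nu : gkeisler R U Y).
Variables (M : set U) (phi : pformula [set: U] (X + Y)).
Hypothesis sM : small K M.
Hypothesis fimM : fim_over K mu M.

Let defmu : borel_definable K mu.
Proof. by exists M; exact: fim_borel_definable. Qed.

(* Average the fim approximation over nu. *)
Lemma fim_mean : exists theta : forall n, pformula M ('I_n.+1 * X),
  (forall eps : R, 0 < eps -> exists N : nat, forall n, (N <= n)%N ->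
    forall a, psat (theta n) a -> 
    `|kval (morley K mu nu) phi - mean_kval nu phi a| <= eps) /\
  (fun n => kval (power K mu n) (globalize (theta n))) @ \oo --> (1 : R).
Proof.
have [W [c [psi psiE]]] := inst_finite_params phi.
have [theta [_ H lim]] := fimM psi; exists theta; split=> // eps eps0.
have [N {}H] := H eps eps0; exists N => n Nn a thetaa.
rewrite kval_morley// /mean_kval.
pose chi i := inst (swap_formula phi) (fun x => a (i, x)).
(* Each nu(phi(a_i,y)) is the integral of an indicator, so both sides become integrals against nu
   that can be compared pointwise. *)
rewrite (_ : _ * _ = kint nu (fun q => n.+1%:R^-1 * \sum_(i < n.+1) `[< q (chi i) >]%:R)).
  rewrite -[leRHS](kint_cst nu); apply: kint_dist.
  - exact: bounded_borel_generic.
  - by apply/bounded_borelZ/bounded_borel_sum => i; exact: bounded_borel_clopen.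
  - exact: bounded_borel_cst.
  (* At a fixed q, one realization b over C computes the generic value and decides all [chi i]; the
     fim estimate is applied to b together with the parameters c of [phi]. *)
  move=> q; have [A [sA inv _]] := defmu.
  have [C [_ sC HC]] := small_realizes_formulas chi sM.
  have [b bq ->] := generic_value_realized Kinf satU q sC
    (invariant_small_inst Kinf phi sA inv).
  rewrite (kval_equiv mu (psiE M b)); apply: ltW.
  rewrite (_ : _ * _ = average R psi a (pair_assign b (val \o c))); first exact: H.
  congr (_ * _); apply: eq_bigr => i _; congr (_%:R); congr (nat_of_bool _).
  apply: asbool_equiv_eq; rewrite (HC q b bq i) psat_inst psat_swap.
  by rewrite -psat_inst (psiE M) psat_inst psat_pure.
rewrite kintZ; last by apply: bounded_borel_sum => i; exact: bounded_borel_clopen.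
rewrite kint_sum; last by move=> i; exact: bounded_borel_clopen.
by congr (_ * _); apply: eq_bigr => i _; rewrite kint_clopen.
Qed.

Lemma mean_kval_itv n (a : 'I_n.+1 * X -> U) : 0 <= mean_kval nu phi a <= 1.
Proof.
rewrite mulr_ge0 ?invr_ge0//=; last by apply: sumr_ge0 => i _; exact: kval_ge0.
rewrite ler_pdivrMl// mulr1 -[X in _ <= X%:R](card_ord n.+1) -sumr_const.
by apply: ler_sum => i _; exact: kval_le1.
Qed.

Lemma fim_commutes : borel_definable K nu ->
  kval (morley K mu nu) phi = kval (morley K nu mu) (swap_formula phi).
Proof.
move=> defnu; have [theta [H lim]] := fim_mean.
set l := kval _ _ in H *; set r := kval _ _.
apply/eqP; rewrite -subr_eq0 -normr_le0; apply/ler_addgt0Pl => e e0; rewrite addr0.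
have e20 : 0 < e / 2 by rewrite divr_gt0.
have [N {}H] := H _ e20.
have : \forall n \near \oo, 1 - e / 2 < kval (power K mu n) (globalize (theta n)).
  by move/cvgrPdist_lt : lim => /(_ _ e20); apply: filterS => n /=;
    rewrite ltr_distlC => /andP[].
move=> [N' _ lim']; pose n := maxn N N'.
have {}lim : 1 - e / 2 < kval (power K mu n) (globalize (theta n)).
  by apply: lim'; exact: leq_maxr.
have {}H a : psat (theta n) a -> `|l - mean_kval nu phi a| <= e / 2.
  by apply: H; exact: leq_maxl.
pose P := power K mu n.
pose G := generic_value K (fun a => kval nu (inst (swap_formula phi) a)).
have bG : bounded_borel G by exact: bounded_borel_generic.
have bGi i := bounded_borel_tpull (pair i) (@subset_refl _ setT) bG.
pose g (q : ctype [set: U] ('I_n.+1 * X)) :=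
  n.+1%:R^-1 * \sum_(i < n.+1) G (tpull (pair i) (@subset_refl _ setT) q).
have bg : bounded_borel g by apply/bounded_borelZ/bounded_borel_sum => i; exact: bGi.
have rE : r = kint P g.
  rewrite kintZ ?kint_sum//; last exact: bounded_borel_sum.
  rewrite (eq_bigr (fun=> r)).
    by rewrite mean_cst.
  move=> i _; rewrite -kint_kpush// (kint_keq _ (power_marginal Kinf satU i defmu)).
  by rewrite [RHS]kval_morley.
(* Pointwise error: e / 2 on [theta n], and at most 1 elsewhere, because both quantities lie between
   0 and 1. The integral of [h] is e / 2 plus the measure of the complement of [theta n], which is
   below e / 2 by the choice of n. *)
pose h (q : ctype [set: U] ('I_n.+1 * X)) : R :=
  e / 2 + `[< q (fnot (globalize (theta n))) >]%:R.
have bh : bounded_borel h.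
  by apply: bounded_borelD; [exact: bounded_borel_cst|exact: bounded_borel_clopen].
have : `|kint P (fun=> l) - kint P g| <= kint P h.
  apply: kint_dist => //; first exact: bounded_borel_cst.
  move=> q; have [A [sA inv _]] := defnu.
  have [B sB invB] := invariant_small_inst Kinf (swap_formula phi) sA inv.
  (* Realizing q over M decides [theta n] at a; realizing it over B makes the value of nu at each
     block a_i the generic one. *)
  have [a aq] := satU (smallU Kinf sM sB) (ctype_restrict (M `|` B) q).
  have -> : g q = mean_kval nu phi a.
    congr (_ * _); apply: eq_bigr => i _.
    apply: (generic_valueE Kinf satU sB invB (b := fun x => a (i, x))).
    by apply: (@realizes_tpull B _ _ (pair i)); apply: realizes_restrictS aq => x; right.
  have aM : realizes a (ctype_restrict M q).
    by apply: realizes_restrictS aq => x; left.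
  rewrite /h; have [qt|/ctype_fnot qnt] := pselect (q (globalize (theta n))).
    by rewrite asboolF ?addr0; [exact/H/aM|move/ctype_fnot].
  rewrite asboolT// -[true%:R]/(1 : R); have /andP[m0 m1] := mean_kval_itv a.
  have l0 := kval_ge0 (morley K mu nu) phi; have l1 := kval_le1 (morley K mu nu) phi.
  rewrite -/l in l0 l1; rewrite ler_norml; apply/andP; split; lra.
rewrite kint_cst -rE kintD ?kint_cst ?kint_clopen ?kval_fnot.
- by move=> /le_trans; apply; rewrite -/P in lim; lra.
- exact: bounded_borel_cst.
- exact: bounded_borel_clopen.
Qed.

End FimMean.

(** For a merely invariant nu the mean may fail to be measurable in a, so it is not integrated. One
    realization a is chosen at which all terms of the mean equal the generic value at p. *)
Lemma fim_type_commutes (X Y : finType) (p : ctype [set: U] X)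
    (nu : gkeisler R U Y) (M : set U) (phi : pformula [set: U] (X + Y)) :
  small K M -> fim_over K (type_measure R p) M -> invariant_measure K nu ->
  kval (morley K (type_measure R p) nu) phi =
  kval (morley_type K nu p) (swap_formula phi).
Proof.
move=> sM fimM [A sA inv]; set mu := type_measure R p in fimM *.
have defmu : borel_definable K mu by exists M; exact: fim_borel_definable.
have [theta [H lim]] := fim_mean nu phi sM fimM.
rewrite [RHS]kval_morley_type//; last by exists A.
apply/eqP; rewrite -subr_eq0 -normr_le0; apply/ler_addgt0Pl => e e0; rewrite addr0.
have [N {}H] := H _ e0.
(* Positive measure is what the argument uses: a set of positive measure meets every set of full
   measure. *)
have : \forall n \near \oo, 0 < kval (power K mu n) (globalize (theta n)).
  move/cvgrPdist_lt : lim => /(_ _ ltr01); apply: filterS => n /=.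
  by rewrite ltr_distlC subrr => /andP[].
move=> [N' _ lim']; pose n := maxn N N'.
have {}lim : 0 < kval (power K mu n) (globalize (theta n)).
  by apply: lim'; exact: leq_maxr.
have {}H a : psat (theta n) a -> `|kval (morley K mu nu) phi - mean_kval nu phi a| <= e.
  by apply: H; exact: leq_maxl.
have [q [qt qp]] : exists q : ctype [set: U] ('I_n.+1 * X), q (globalize (theta n)) /\
    forall i, tpull (pair i) (@subset_refl _ setT) q = p.
  set P := power K mu n in lim.
  have mp : measurable ([set p] : set (borel [set: U] X)).
    rewrite -[X in measurable X]setCK; apply: measurableC; apply: sub_sigma_algebra.
    apply: closed_openC; apply: accessible_closed_set1.
    exact/hausdorff_accessible/hausdorff_ctype.
  (* The i-th marginal of P is the Dirac measure at p, which gives measure 0 to the complement of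
     the closed point p. *)
  have ae i : {ae P, forall q : borel [set: U] ('I_n.+1 * X),
      tpull (pair i) (@subset_refl _ setT) q = p}.
    exists (tpull (pair i) (@subset_refl _ setT) @^-1` (~` [set p])); split=> //.
      rewrite -[X in measurable X]setTI; apply: measurable_tpull => //.
      exact: measurableC.
    transitivity (kpush (pair i) (@subset_refl _ setT) P (~` [set p])); first by [].
    rewrite (power_marginal Kinf satU i defmu); last exact: measurableC.
    by rewrite /= diracE memNset//; exact.
  have [Z [mZ Z0 sZ]] : {ae P, forall q : borel [set: U] ('I_n.+1 * X),
      forall i, tpull (pair i) (@subset_refl _ setT) q = p}.
    exact: filter_forall.
  apply: contrapT => nex.
  (* If no such q existed, [theta n] would be contained in the null set [Z]. *)
  have : (P (clopen_of (globalize (theta n))) <= P Z)%E.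
    apply: le_measure; rewrite ?inE//; first exact: measurable_clopen_of.
    by move=> q qt; apply: sZ => qp; apply: nex; exists q.
  by rewrite Z0 -kvalE lee_fin leNgt lim.
have [B sB invB] := invariant_small_inst Kinf (swap_formula phi) sA inv.
have [a aq] := satU (smallU Kinf sM sB) (ctype_restrict (M `|` B) q).
have aM : realizes a (ctype_restrict M q).
  by apply: realizes_restrictS aq => x; left.
have <- : mean_kval nu phi a =
    generic_value K (fun a => kval nu (inst (swap_formula phi) a)) p.
  rewrite /mean_kval (eq_bigr (fun=> generic_value K
    (fun a => kval nu (inst (swap_formula phi) a)) p)).
    exact: mean_cst.
  move=> i _; apply/esym; rewrite -(qp i).
  apply: (generic_valueE Kinf satU sB invB (b := fun x => a (i, x))).
  by apply: (@realizes_tpull B _ _ (pair i)); apply: realizes_restrictS aq => x; right.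
exact/H/aM.
Qed.

End Commutation.

Theorem theorem5p16 (R : realType) (L : language) (T : set (sentence L))
  (U : structure L) (K : Type) (hT : complete_theory T) (hU : monster U K T)
  (X Y : finType) :
  (forall (mu : gkeisler R U X) (nu : gkeisler R U Y),
     fim K mu -> borel_definable K nu ->
     keq (morley K mu nu) (kswap (morley K nu mu))) /\
  (forall (p : ctype [set: U]%classic X) (nu : gkeisler R U Y),
     fim K (type_measure R p) -> invariant_measure K nu ->
     keq (morley K (type_measure R p) nu) (kswap (morley_type K nu p))).
Proof.
have Kinf := monster_infinite hU; have [_ _ satU _] := hU.
split=> [mu nu [M [sM _ fimM]] defnu|p nu [M [sM _ fimM]] inv]; apply: kval_keq => phi.
  by rewrite kval_kpush (fim_commutes Kinf satU phi sM fimM defnu).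
by rewrite kval_kpush (fim_type_commutes Kinf satU phi sM fimM inv).
Qed.
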